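(* Let $n\ge 1$, let $\Gamma\subset\mathbb{R}^n$ be an open convex symmetric cone containing the positive diagonal $\{(\lambda,\dots,\lambda) : \lambda>0\}$, and let $F:\Gamma\to\mathbb{R}$ be a smooth symmetric function such that $$F>0 \quad\text{and}\quad \frac{\partial F}{\partial\lambda_i}>0 \ \text{ for all } i=1,\dots,n, \quad\text{everywhere on } \Gamma .$$ Let $-\infty\le T_0<T_1\le+\infty$, let $M$ be a closed connected $n$-dimensional smooth manifold, and let $\varphi:M\times(T_0,T_1)\to\mathbb{R}^{n+1}$ be a smooth, embedded solution of the flow $$\frac{\partial\varphi}{\partial t}=\frac{\nu}{F},$$ with $M_t=\varphi(M,t)$. Suppose that $M_t$ comes out of a point of $\mathbb{R}^{n+1}$. Then $M_t$ is a family of expanding spheres, that is, there exist a point $y\in\mathbb{R}^{n+1}$ and a strictly increasing function $r:(T_0,T_1)\to(0,\infty)$ such that $M_t=\{x\in\mathbb{R}^{n+1} : |x-y|=r(t)\}$ for every $t\in(T_0,T_1)$.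
   Context: A cone $\Gamma\subset\mathbb{R}^n$ is symmetric if it is invariant under permutations of the coordinates; a function on $\Gamma$ is symmetric if it is invariant under permutations of its arguments. A smooth, embedded solution of the flow $\partial\varphi/\partial t=\nu/F$ on $(T_0,T_1)$ is a smooth map $\varphi:M\times(T_0,T_1)\to\mathbb{R}^{n+1}$ such that, for every $t$: the map $\varphi(\cdot,t)$ is a smooth embedding of the closed (compact, without boundary) manifold $M$; its image $M_t=\varphi(M,t)$ is admissible for $F$, meaning that at every point of $M_t$ the vector of principal curvatures $(\lambda_1,\dots,\lambda_n)$ belongs to $\Gamma$; and $$\frac{\partial\varphi}{\partial t}(p,t)=\frac{\nu(p,t)}{F(\lambda_1(p,t),\dots,\lambda_n(p,t))}\qquad\text{for all } p\in M.$$ Here $\nu(p,t)$ is the unit normal to $M_t$ at $\varphi(p,t)$ pointing out of the bounded open domain $\Omega_t$ whose boundary is $M_t$, and $\lambda_1(p,t),\dots,\lambda_n(p,t)$ are the principal curvatures of $M_t$ at $\varphi(p,t)$, with the sign convention that a round sphere of radius $r$ has all principal curvatures equal to $1/r>0$. The time $T_0$ may be finite or $-\infty$. A solution $M_t$ comes out of a point $y_\infty\in\mathbb{R}^{n+1}$ if for every $r>0$ there exists a time $\overline{t}\in(T_0,T_1)$ such that $M_{\overline{t}}\subset B_r(y_\infty)$, where $B_r(y_\infty)$ is the ball of radius $r$ centered at $y_\infty$. *)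

(* Defs.v *)
From HB Require Import structures.
From mathcomp Require Import all_boot all_order all_algebra all_fingroup.
From mathcomp Require Import all_classical all_reals all_analysis.

Set Implicit Arguments.
Unset Strict Implicit.
Unset Printing Implicit Defensive.

Import Order.TTheory GRing.Theory Num.Theory.
Import numFieldNormedType.Exports.

Local Open Scope classical_set_scope.
Local Open Scope ring_scope.

(* The library's norm on row vectors is the sup norm: it induces the right
   topology, but lengths and angles need the Euclidean inner product. *)
Definition dot (R : realType) (m : nat) (u v : 'rV[R]_m) : R :=
  \sum_(i < m) u 0 i * v 0 i.

Definition enorm (R : realType) (m : nat) (u : 'rV[R]_m) : R :=
  Num.sqrt (dot u u).

Definition eball (R : realType) (m : nat) (y : 'rV[R]_m) (r : R) :
  set 'rV[R]_m := [set x | enorm (x - y) < r].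

Definition esphere (R : realType) (m : nat) (y : 'rV[R]_m) (r : R) :
  set 'rV[R]_m := [set x | enorm (x - y) = r].

(* [iter_derive [:: v1; ...; vk] f] is D_v1 (... (D_vk f)). *)
Definition iter_derive (R : realType) (V W : normedModType R)
    (s : seq V) (f : V -> W) : V -> W :=
  foldr (fun v g => 'D_v g) f s.

(* C^oo on U, meant for open U: at points of an open set, ['D_v] only depends
   on the values of the function in that set. *)
Definition smooth_on (R : realType) (V W : normedModType R)
    (U : set V) (f : V -> W) : Prop :=
  forall (s : seq V) (x : V), U x ->
    {for x, continuous (iter_derive s f)} /\
    (forall v : V, derivable (iter_derive s f) x v).

(* Total functions; their values outside [chart_dom] and [chart_cod] are
   irrelevant. *)
Record chart (R : realType) (n : nat) (M : topologicalType) := Chart {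
  chart_dom : set M ;
  chart_cod : set 'rV[R]_n ;
  chart_fun : M -> 'rV[R]_n ;
  chart_inv : 'rV[R]_n -> M ;
  chart_dom_open : open chart_dom ;
  chart_cod_open : open chart_cod ;
  chart_funS : forall p, chart_dom p -> chart_cod (chart_fun p) ;
  chart_invS : forall u, chart_cod u -> chart_dom (chart_inv u) ;
  chart_funK : forall p, chart_dom p -> chart_inv (chart_fun p) = p ;
  chart_invK : forall u, chart_cod u -> chart_fun (chart_inv u) = u ;
  chart_fun_continuous : {within chart_dom, continuous chart_fun} ;
  chart_inv_continuous : {within chart_cod, continuous chart_inv} }.

(* The atlas need not be maximal: smoothness of maps, tangent spaces and
   curvatures do not change when compatible charts are added. *)
Record smooth_manifold (R : realType) (n : nat) (M : topologicalType)
    (A : set (chart R n M)) : Prop := SmoothManifold {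
  manifold_hausdorff : hausdorff_space M ;
  manifold_second_countable : @second_countable M ;
  manifold_cover : forall p : M, exists2 c, A c & chart_dom c p ;
  manifold_compatible : forall c c', A c -> A c' ->
    smooth_on (chart_fun c @` (chart_dom c `&` chart_dom c'))
              (chart_fun c' \o chart_inv c) }.

Definition closed_connected_manifold (R : realType) (n : nat)
    (M : topologicalType) (A : set (chart R n M)) : Prop :=
  [/\ smooth_manifold A, compact [set: M] & connected [set: M]].

Definition local_rep (R : realType) (n m : nat) (M : topologicalType)
    (f : M -> 'rV[R]_m) (c : chart R n M) : 'rV[R]_n -> 'rV[R]_m :=
  f \o chart_inv c.

(* The rows of the library's Jacobian ['J X u] are the partial derivatives
   of X. *)
Record smooth_embedding (R : realType) (n m : nat) (M : topologicalType)
    (A : set (chart R n M)) (f : M -> 'rV[R]_m) : Prop := SmoothEmbedding {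
  embedding_smooth : forall c, A c -> smooth_on (chart_cod c) (local_rep f c) ;
  embedding_immersion : forall c p, A c -> chart_dom c p ->
    row_free ('J (local_rep f c) (chart_fun c p)) ;
  embedding_injective : injective f ;
  embedding_topology : forall U : set M, open U ->
    exists2 V : set 'rV[R]_m, open V & U = f @^-1` V }.

Definition bounded_domain_of (R : realType) (m : nat) (Omega S : set 'rV[R]_m)
    : Prop :=
  [/\ open Omega, connected Omega, Omega !=set0, bounded_set Omega
    & closure Omega `\` Omega = S].

Definition outward_unit_normal (R : realType) (n m : nat) (M : topologicalType)
    (A : set (chart R n M)) (f : M -> 'rV[R]_m) (Omega : set 'rV[R]_m)
    (p : M) (nu : 'rV[R]_m) : Prop :=
  [/\ enorm nu = 1,
      forall c, A c -> chart_dom c p ->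
        'J (local_rep f c) (chart_fun c p) *m nu^T = 0
    & \forall s \near (0 : R)^'+,
        Omega (f p - s *: nu) /\ ~ closure Omega (f p + s *: nu)].

Definition first_form (R : realType) (n m : nat) (X : 'rV[R]_n -> 'rV[R]_m)
    (u : 'rV[R]_n) : 'M[R]_n :=
  'J X u *m ('J X u)^T.

(* The minus sign makes spheres positively curved for the outward normal. *)
Definition second_form (R : realType) (n m : nat) (X : 'rV[R]_n -> 'rV[R]_m)
    (u : 'rV[R]_n) (nu : 'rV[R]_m) : 'M[R]_n :=
  \matrix_(i, j)
    - dot ('D_(delta_mx 0 i) ('D_(delta_mx 0 j) X) u) nu.

(* Matrix, acting on row vectors, of the shape operator in the basis of
   coordinate tangent vectors. *)
Definition shape_operator (R : realType) (n m : nat)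
    (X : 'rV[R]_n -> 'rV[R]_m) (u : 'rV[R]_n) (nu : 'rV[R]_m) : 'M[R]_n :=
  second_form X u nu *m invmx (first_form X u).

(* lam lists, in some order, the eigenvalues of the shape operator with
   multiplicity. *)
Definition principal_curvatures (R : realType) (n m : nat)
    (M : topologicalType) (A : set (chart R n M)) (f : M -> 'rV[R]_m) (p : M)
    (nu : 'rV[R]_m) (lam : 'rV[R]_n) : Prop :=
  forall c, A c -> chart_dom c p ->
    char_poly (shape_operator (local_rep f c) (chart_fun c p) nu)
    = \prod_(i < n) ('X - (lam 0 i)%:P).

Definition symmetric_set (R : realType) (n : nat) (G : set 'rV[R]_n) : Prop :=
  forall (s : 'S_n) (x : 'rV[R]_n), G x -> G (col_perm s x).

Definition symmetric_fun_on (R : realType) (n : nat) (G : set 'rV[R]_n)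
    (F : 'rV[R]_n -> R) : Prop :=
  forall (s : 'S_n) (x : 'rV[R]_n), G x -> F (col_perm s x) = F x.

Definition cone (R : realType) (n : nat) (G : set 'rV[R]_n) : Prop :=
  forall (a : R) (x : 'rV[R]_n), 0 < a -> G x -> G (a *: x).

Definition open_itv (R : realType) (T0 T1 : \bar R) : set R :=
  [set t | (T0 < t%:E < T1)%E].

(* phi p t is only constrained for t in (T0, T1). As F is symmetric on the
   symmetric set G, the order of the principal curvatures is immaterial. *)
Record smooth_embedded_solution (R : realType) (n : nat) (M : topologicalType)
    (A : set (chart R n M)) (G : set 'rV[R]_n) (F : 'rV[R]_n -> R)
    (T0 T1 : \bar R) (phi : M -> R -> 'rV[R]_n.+1) : Prop := SmoothSolution {
  solution_smooth : forall c, A c ->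
    smooth_on [set ut : 'rV[R]_n * R |
                 chart_cod c ut.1 /\ open_itv T0 T1 ut.2]
              (fun ut => phi (chart_inv c ut.1) ut.2) ;
  solution_embedded : forall t, open_itv T0 T1 t ->
    smooth_embedding A (phi^~ t) ;
  solution_flow : forall t, open_itv T0 T1 t ->
    exists2 Omega, bounded_domain_of Omega (range (phi^~ t)) &
      forall p, exists nu lam,
        [/\ outward_unit_normal A (phi^~ t) Omega p nu,
            principal_curvatures A (phi^~ t) p nu lam,
            G lam
          & derive1 (phi p) t = (F lam)^-1 *: nu] }.

Definition comes_out_of (R : realType) (m : nat) (M : Type) (T0 T1 : \bar R)
    (phi : M -> R -> 'rV[R]_m) (y : 'rV[R]_m) : Prop :=
  forall r : R, 0 < r ->
    exists2 t, open_itv T0 T1 t & range (phi^~ t) `<=` eball y r.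

(* Main.v *)
(** For the time-shifted two-point function
      Q(p, q, t) = |x - y|^2 - |z - y|^2 - 2 C(t) |x - z|,   x = phi(p, t - h),  z = phi(q, t),
    where M_{t0} lies in the ball of radius r around y and C increases slowly from r,
    negativity of Q is preserved by the flow.  At a first zero of Q the reflection in the
    hyperplane bisecting x and z, which is orthogonal to the unit vector V = (x - z) / |x - z|
    and contains c = y + C V, exchanges the two tangent planes; the second variation along
    reflected directions orders the principal curvatures, hence the speeds 1/F, and
    contradicts C' > 0.  The shift h > 0 keeps x inside the domain bounded by M_t, since the
    flow expands, so that x <> z and no boundary case on the diagonal arises.  Letting h and
    then r tend to 0 gives |x - y| <= |z - y| for all x, z in M_t: this is the Alexandrov
    reflection principle for all hyperplanes at once, and it confines M_t to a sphere. *)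
Require Import Defs.
From HB Require Import structures.
From mathcomp Require Import all_boot all_order all_algebra all_fingroup.
From mathcomp Require Import all_classical all_reals all_analysis.
From mathcomp Require Import ring lra.

Set Implicit Arguments.
Unset Strict Implicit.
Unset Printing Implicit Defensive.

Import Order.TTheory GRing.Theory Num.Theory.
Import numFieldNormedType.Exports.

Local Open Scope classical_set_scope.
Local Open Scope ring_scope.

(** * The Euclidean inner product and bounded domains *)

(** The starting constant comes from |x - y|^2 - |z - y|^2 = (|x - y| - |z - y|)(|x - y| + |z - y|):
    when the first factor is positive it is at most |x - z|, and the second is below 2 |x - y| < 2
    r. Tangency at a contact only gives x - c = k nu_x and z - c = k' nu_z with k^2 = k'^2 nonzero,
    and ordering the speeds helps only for the right signs. A negative k' is excluded globally: a
    segment from x to a point outside the domain must meet M_t. If k = - k' < 0, the time derivative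
    has the wrong sign at once. Only k = k' > 0 needs curvatures. These are given merely as roots of
    a characteristic polynomial, in unknown order; so the quadratic forms are compared by a
    dimension count on sorted spectra, and F is compared along a segment of the convex set. The
    domain bounded by M_t is given separately at each time, so expansion has to be proved: the flow
    is locally injective in space-time, hence nearby slices are disjoint, and the past of each point
    stays on one side of M_t. *)

Lemma dotC (R : realType) m (u v : 'rV[R]_m) : dot u v = dot v u.
Proof. by rewrite /dot; apply: eq_bigr => i _; rewrite mulrC. Qed.

Lemma dotDl (R : realType) m (u v w : 'rV[R]_m) :
  dot (u + v) w = dot u w + dot v w.
Proof. by rewrite /dot -big_split; apply: eq_bigr => i _; rewrite mxE mulrDl. Qed.

Lemma dotZl (R : realType) m a (u v : 'rV[R]_m) : dot (a *: u) v = a * dot u v.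
Proof. by rewrite /dot mulr_sumr; apply: eq_bigr => i _; rewrite mxE mulrA. Qed.

Lemma dotNl (R : realType) m (u v : 'rV[R]_m) : dot (- u) v = - dot u v.
Proof. by rewrite -scaleN1r dotZl mulN1r. Qed.

Lemma dotDr (R : realType) m (u v w : 'rV[R]_m) :
  dot w (u + v) = dot w u + dot w v.
Proof. by rewrite !(dotC w) dotDl. Qed.

Lemma dotZr (R : realType) m a (u v : 'rV[R]_m) : dot v (a *: u) = a * dot v u.
Proof. by rewrite !(dotC v) dotZl. Qed.

Lemma dotNr (R : realType) m (u v : 'rV[R]_m) : dot v (- u) = - dot v u.
Proof. by rewrite !(dotC v) dotNl. Qed.

Lemma dot0l (R : realType) m (v : 'rV[R]_m) : dot 0 v = 0.
Proof. by rewrite -(scale0r 0) dotZl mul0r. Qed.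

Definition dotE := (dotDl, dotDr, dotNl, dotNr, dotZl, dotZr).

Lemma dot_mx (R : realType) m (u v : 'rV[R]_m) : dot u v = (u *m v^T) 0 0.
Proof. by rewrite /dot mxE; apply: eq_bigr => i _; rewrite mxE. Qed.

Lemma dot_mulmx (R : realType) m k (u : 'rV[R]_m) (A : 'M[R]_(m, k)) v :
  dot (u *m A) v = dot u (v *m A^T).
Proof. by rewrite !dot_mx trmx_mul trmxK mulmxA. Qed.

Lemma dot_ge0 (R : realType) m (u : 'rV[R]_m) : 0 <= dot u u.
Proof. by apply: sumr_ge0 => i _; rewrite -expr2 sqr_ge0. Qed.

Lemma dot_eq0 (R : realType) m (u : 'rV[R]_m) : (dot u u == 0) = (u == 0).
Proof.
apply/idP/eqP => [|->]; last by rewrite dot0l.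
rewrite psumr_eq0 => [/allP u0|i _]; last by rewrite -expr2 sqr_ge0.
apply/rowP => i; have := u0 i (mem_index_enum _).
by rewrite -expr2 sqrf_eq0 mxE => /eqP.
Qed.

Lemma dot_gt0 (R : realType) m (u : 'rV[R]_m) : (0 < dot u u) = (u != 0).
Proof. by rewrite lt_neqAle dot_ge0 andbT eq_sym dot_eq0. Qed.

Lemma enorm_ge0 (R : realType) m (u : 'rV[R]_m) : 0 <= enorm u.
Proof. exact: sqrtr_ge0. Qed.

Lemma enorm_sqr (R : realType) m (u : 'rV[R]_m) : enorm u ^+ 2 = dot u u.
Proof. by rewrite sqr_sqrtr ?dot_ge0. Qed.

Lemma enorm_gt0 (R : realType) m (u : 'rV[R]_m) : (0 < enorm u) = (u != 0).
Proof. by rewrite sqrtr_gt0 dot_gt0. Qed.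

Lemma enormZ (R : realType) m a (u : 'rV[R]_m) : enorm (a *: u) = `|a| * enorm u.
Proof. by rewrite /enorm !dotE mulrA -expr2 sqrtrM ?sqr_ge0// sqrtr_sqr. Qed.

Lemma le_enorm (R : realType) m k (u : 'rV[R]_m) (v : 'rV[R]_k) :
  (enorm u <= enorm v) = (dot u u <= dot v v).
Proof. by rewrite ler_sqrt ?dot_ge0. Qed.

Lemma lt_enorm (R : realType) m k (u : 'rV[R]_m) (v : 'rV[R]_k) :
  (enorm u < enorm v) = (dot u u < dot v v).
Proof. by rewrite !ltNge le_enorm. Qed.

Lemma dot_le_enorm (R : realType) m (u v : 'rV[R]_m) :
  dot u v <= enorm u * enorm v.
Proof.
have [->|u0] := eqVneq u 0; first by rewrite dot0l mulr_ge0 ?enorm_ge0.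
have := dot_ge0 (dot u u *: v - dot u v *: u).
rewrite !dotE (dotC v u) => h.
have {}h : dot u v ^+ 2 <= dot u u * dot v v.
  have u_gt0 : 0 < dot u u by rewrite dot_gt0.
  rewrite -(ler_pM2l u_gt0) -subr_ge0; apply: le_trans h _.
  by rewrite le_eqVlt; apply/orP; left; apply/eqP; ring.
apply: le_trans (ler_norm _) _.
rewrite -(@ler_pXn2r _ 2) ?nnegrE ?mulr_ge0 ?enorm_ge0//.
by rewrite real_normK ?num_real// exprMn !enorm_sqr.
Qed.

Lemma ler_enormD (R : realType) m (u v : 'rV[R]_m) :
  enorm (u + v) <= enorm u + enorm v.
Proof.
rewrite -(@ler_pXn2r _ 2) ?nnegrE ?addr_ge0 ?enorm_ge0//.
rewrite enorm_sqr !dotE sqrrD !enorm_sqr (dotC v u).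
have := dot_le_enorm u v; lra.
Qed.

Lemma norm_dot_le (R : realType) m (u v : 'rV[R]_m) :
  `|dot u v| <= (m%:R : R) * (`|u| * `|v|).
Proof.
apply: le_trans (ler_norm_sum _ _ _) _.
rewrite -[m in m%:R]card_ord -sum1_card natr_sum mulr_suml.
apply: ler_sum => i _; rewrite mul1r normrM ler_pM//.
  by rewrite [leRHS]/Num.Def.normr/= mx_normrE (le_bigmax _ (fun ij => `|u ij.1 ij.2|) (0, i)).
by rewrite [leRHS]/Num.Def.normr/= mx_normrE (le_bigmax _ (fun ij => `|v ij.1 ij.2|) (0, i)).
Qed.

Lemma norm_le_enorm (R : realType) m (u : 'rV[R]_m) : `|u| <= enorm u.
Proof.
rewrite [leLHS]/Num.Def.normr/= mx_normrE.
apply: bigmax_le => [|[i j] _]; first exact: enorm_ge0.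
rewrite ord1 /= -(@ler_pXn2r _ 2) ?nnegrE ?enorm_ge0// real_normK ?num_real//.
rewrite enorm_sqr /dot (bigD1 j)//= -expr2 lerDl.
by apply: sumr_ge0 => k _; rewrite -expr2 sqr_ge0.
Qed.

Lemma cvg_dot (R : realType) m (T : Type) (F : set_system T) {FF : Filter F}
    (f g : T -> 'rV[R]_m) u v :
  f @ F --> u -> g @ F --> v -> (fun x => dot (f x) (g x)) @ F --> dot u v.
Proof.
move=> fu gv; apply: cvg_big => [|i _]; first exact: add_continuous.
have co (w : 'rV[R]_m) : (fun w' : 'rV[R]_m => w' 0 i) @ w --> w 0 i.
  exact: coord_continuous.
by apply: cvgM; [apply: (cvg_comp f (fun w : 'rV[R]_m => w 0 i) fu); exact: co|apply: (cvg_comp g (fun w : 'rV[R]_m => w 0 i) gv); exact: co].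
Qed.

Lemma cvg_enorm (R : realType) m (T : Type) (F : set_system T) {FF : Filter F}
    (f : T -> 'rV[R]_m) u :
  f @ F --> u -> (fun x => enorm (f x)) @ F --> enorm u.
Proof.
move=> fu; apply: (cvg_comp (fun x => dot (f x) (f x)) Num.sqrt).
  exact: (cvg_dot fu fu).
exact: sqrt_continuous.
Qed.

(** The domain and the complement of its closure are separated and cover everything except the
    boundary [S], so a connected set avoiding [S] cannot pass from one to the other. *)
Lemma connected_in_domain (R : realType) m (Om S E : set 'rV[R]_m) :
  bounded_domain_of Om S -> connected E -> E `&` Om !=set0 ->
  (forall x, E x -> ~ S x) -> E `<=` Om.
Proof.
move=> [Omo _ _ _ <-] Ec [e [Ee Ome]] ES.
have sep : separated Om (~` closure Om).
  split; rewrite -subset0 => x [].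
    by move=> cx; apply.
  move=> Ox /(_ Om) []; first exact: open_nbhs_nbhs.
  by move=> w [nw Ow]; apply: nw; exact: subset_closure.
have sub : E `<=` Om `|` ~` closure Om.
  move=> x Ex; have [Ox|nOx] := pselect (Om x); [by left|right => cx].
  by apply: (ES x Ex); split.
have [//|E2] := connected_subset sep sub Ec.
by case: (E2 e Ee); exact: subset_closure.
Qed.

Lemma domain_disjoint (R : realType) m (Om S : set 'rV[R]_m) x :
  bounded_domain_of Om S -> Om x -> ~ S x.
Proof. by move=> [_ _ _ _ <-] Ox []. Qed.

Lemma segment_in_domain (R : realType) m (Om S : set 'rV[R]_m) x w :
  bounded_domain_of Om S -> Om x ->
  (forall th : R, 0 <= th <= 1 -> ~ S ((1 - th) *: x + th *: w)) -> Om w.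
Proof.
move=> hOm Ox hS.
pose f th : 'rV[R]_m := (1 - th) *: x + th *: w.
suff : f @` `[0, 1] `<=` Om.
  by apply; exists 1; rewrite /f /= ?in_itv/= ?lexx ?ler01// subrr scale0r add0r scale1r.
apply: (connected_in_domain hOm).
- apply: connected_continuous_connected; first exact: segment_connected.
  apply: continuous_subspaceT => t; rewrite /f.
  apply: cvgD; apply: cvgZr_tmp; last exact: cvg_id.
  by apply: cvgB; [exact: cvg_cst|exact: cvg_id].
- exists x; split => //; exists 0; first by rewrite /= in_itv/= lexx ler01.
  by rewrite /f subr0 scale1r scale0r addr0.
- by move=> _ [th + <-]; rewrite /= in_itv/=; exact: hS.
Qed.

(** The ray from [o] pointing away from [y] has to leave the bounded domain, and it can do so only
    through [S]. *)
Lemma domain_ray (R : realType) m (Om S : set 'rV[R]_m.+1) o y :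
  bounded_domain_of Om S -> Om o ->
  exists2 w, S w & enorm (o - y) < enorm (w - y).
Proof.
move=> hOm Oo; apply: contrapT => nex.
(* For [o = y] there is no preferred direction; any nonzero vector moves away from [y]. *)
pose e : 'rV[R]_m.+1 := if o == y then delta_mx 0 0 else o - y.
have e0 : e != 0.
  rewrite /e; case: (eqVneq o y) => [_|oy]; last by rewrite subr_eq0.
  apply/eqP => /matrixP/(_ 0 0)/eqP; rewrite !mxE !eqxx/= mulr1n.
  by rewrite (negbTE (oner_neq0 R)).
pose f t : 'rV[R]_m.+1 := o + t *: e.
have fS t : 0 <= t -> ~ S (f t).
  rewrite le_eqVlt => /predU1P[<-|t0] Sf.
    by apply: (domain_disjoint hOm Oo); move: Sf; rewrite /f scale0r addr0.
  apply: nex; exists (f t) => //; rewrite /f /e; case: (eqVneq o y) => [oy|oy].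
    rewrite oy subrr addrAC subrr add0r lt_enorm dot0l dot_gt0 scaler_eq0.
    by rewrite gt_eqF//=; move: e0; rewrite /e oy eqxx.
  have -> : o + t *: (o - y) - y = (1 + t) *: (o - y).
    by rewrite scalerDl scale1r addrAC.
  rewrite enormZ gtr0_norm ?addr_gt0// ltr_pMl ?ltrDl//.
  by rewrite enorm_gt0 subr_eq0.
have sub : f @` `[0, +oo[ `<=` Om.
  apply: (connected_in_domain hOm).
  - apply: connected_continuous_connected; first exact/connected_intervalP/interval_is_interval.
    apply: continuous_subspaceT => t; rewrite /f.
    by apply: cvgD; [exact: cvg_cst|apply: cvgZr_tmp; exact: cvg_id].
  - exists o; split => //; exists 0; first by rewrite /= in_itv/= lexx.
    by rewrite /f scale0r addr0.
  - by move=> _ [t + <-]; rewrite /= in_itv/= andbT; exact: fS.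
have [_ _ _ Ob _] := hOm.
have [M [Mr hM]] := Ob.
pose M' := `|M| + 1.
have MM : M < M' by rewrite /M' ltr_pwDr// ler_norm.
pose t := (M' + `|o| + 1) / `|e|.
have e_gt0 : 0 < `|e| by rewrite normr_gt0.
have t0 : 0 <= t by rewrite divr_ge0// addr_ge0// addr_ge0// /M' addr_ge0.
have Of : Om (f t) by apply: sub; exists t; rewrite //= in_itv/= t0.
have := hM M' MM (f t) Of; rewrite /f; apply/negP; rewrite -ltNge.
have : `|t *: e| <= `|o + t *: e| + `|o|.
  by rewrite -{1}[t *: e](addKr o) addrC (le_trans (ler_normB _ _)) // addrC.
rewrite normrZ ger0_norm// /t divfK ?gt_eqF//; lra.
Qed.

(** * Continuously differentiable maps *)

Lemma is_derive_line (R : realType) (V W : normedModType R) (f : V -> W) x v (t : R) :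
  derivable f (x + t *: v) v ->
  is_derive t 1 (fun s : R => f (x + s *: v)) ('D_v f (x + t *: v)).
Proof.
move=> df.
have e : (fun h : R => h^-1 *: (((fun s : R => f (x + s *: v)) \o shift t) (h *: 1) - f (x + t *: v)))
    = (fun h : R => h^-1 *: ((f \o shift (x + t *: v)) (h *: v) - f (x + t *: v))).
  apply: funext => h /=; congr (_ *: (f _ - _)).
  by rewrite [h *: 1]mulr1 scalerDl addrCA.
by apply: DeriveDef; [rewrite /derivable e|rewrite /derive e].
Qed.

Lemma MVT_line (R : realType) (V : normedModType R) (f : V -> R) x v :
  (forall t : R, 0 <= t <= 1 -> derivable f (x + t *: v) v) ->
  exists2 t : R, 0 <= t <= 1 & f (x + v) - f x = 'D_v f (x + t *: v).
Proof.
move=> df.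
have [||t /itvP t01] := @MVT R (fun s => f (x + s *: v)) (fun s => 'D_v f (x + s *: v)) 0 1 ltr01.
- move=> t /itvP t01; apply: is_derive_line; apply: df.
  by rewrite !t01.
- apply: derivable_within_continuous => t /itvP t01.
  by have [] := is_derive_line (df t _); rewrite ?t01.
rewrite scale1r scale0r addr0 subr0 mulr1 => ->.
by exists t => //; rewrite !t01.
Qed.

(** On the line through [x] this is the chain rule for one real variable, which also covers
    [a = 0]. *)
Lemma deriveZdir (R : realType) (V W : normedModType R) (f : V -> W) x v (a : R) :
  derivable f x v -> 'D_(a *: v) f x = a *: 'D_v f x.
Proof.
move=> df; pose g (s : R) := f (x + s *: v).
have dg : is_derive (0 : R) (1 : R) g ('D_v f x).
  by have := @is_derive_line R V W f x v 0; rewrite scale0r addr0; exact.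
have dg' : differentiable g (a * 0) by rewrite mulr0; apply/derivable1_diffP; case: dg.
have e : (fun h : R => h^-1 *: ((f \o shift x) (h *: (a *: v)) - f x)) =
    (fun h : R => h^-1 *: (((g \o *%R a) \o shift 0) (h *: 1) - (g \o *%R a) 0)).
  apply: funext => h /=.
  rewrite /g addr0 mulr0 scale0r addr0 scalerA [h *: 1]mulr1.
  by rewrite [_ *: v + x]addrC (mulrC h).
have -> : 'D_(a *: v) f x = 'D_1 (g \o *%R a) 0 by rewrite /derive e.
have da : is_derive (0 : R) (1 : R) ( *%R a) a.
  by apply: (@is_derive_eq _ _ _ (a \*: id)); rewrite [_ *: _]mulr1.
have da' : differentiable ( *%R a) (0 : R) by apply/derivable1_diffP; case: da.
have dc : differentiable (g \o *%R a) (0 : R) by exact: differentiable_comp da' dg'.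
rewrite (deriveE _ dc) diff_comp// /= -(deriveE _ da') derive_val mulr0.
rewrite deriv1E; last by case: dg.
by rewrite derive1E derive_val.
Qed.

(** Only directional derivatives are asked for. Linearity in the direction and the differential are
    recovered from their continuity through the mean value theorem. *)
Definition C1_on (R : realType) (V W : normedModType R) (U : set V) (f : V -> W) :=
  open U /\ forall x, U x -> forall v, derivable f x v /\ {for x, continuous ('D_v f)}.

Lemma smooth_on_C1 (R : realType) (V W : normedModType R) (U : set V) (f : V -> W) :
  open U -> smooth_on U f -> C1_on U f.
Proof.
move=> Uo sf; split => // x Ux v; split; first by have [_] := sf [::] x Ux; exact.
by have [] := sf [:: v] x Ux.
Qed.

Lemma smooth_on_derive (R : realType) (V W : normedModType R) (U : set V) (f : V -> W) v :
  smooth_on U f -> smooth_on U ('D_v f).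
Proof. by move=> sf s x Ux; have := sf (rcons s v) x Ux; rewrite /iter_derive foldr_rcons. Qed.

Lemma C1_on_coord (R : realType) (V : normedModType R) m n (U : set V)
    (f : V -> 'M[R]_(m, n)) i j : C1_on U f ->
  C1_on U (fun x => f x i j) /\
  forall x v, U x -> 'D_v (fun x => f x i j) x = ('D_v f x) i j.
Proof.
move=> [Uo df].
have E x v : U x -> 'D_v (fun x => f x i j) x = ('D_v f x) i j.
  by move=> Ux; rewrite derive_mx ?mxE//; have [] := df x Ux v.
split => //; split => // x Ux v; have [dx cx] := df x Ux v; split.
  by move/derivable_mxP : dx; exact.
have U0 : \forall y \near x, U y by exact: open_nbhs_nbhs.
apply: cvg_trans (_ : (fun y => ('D_v f y) i j) @ x --> _).
  by apply: near_eq_cvg; near=> y; rewrite E//; near: y.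
rewrite E//; apply: (cvg_comp ('D_v f) (fun w : 'M[R]_(m, n) => w i j) cx).
exact: coord_continuous.
Unshelve. all: by end_near. Qed.

(** The increment along [h *: (v + w)] is split at [x + h *: v]: one leg is the quotient defining
    ['D_v f x], the other is ['D_w f] at a nearby point, which converges by continuity. *)
Lemma derive_addr_dir (R : realType) (V : normedModType R) (U : set V) (f : V -> R) x v w :
  C1_on U f -> U x -> 'D_(v + w) f x = 'D_v f x + 'D_w f x.
Proof.
move=> [Uo df] Ux; have [dv _] := df x Ux v; have [_ cw] := df x Ux w.
have U0 : \forall y \near x, U y by exact: open_nbhs_nbhs.
apply: cvg_lim => //; apply/cvgrPdist_le => /= e e0.
have e2 : 0 < e / 2 by rewrite divr_gt0.
have [r r0 hr] : exists2 r : R, 0 < r & forall y, `|y - x| < r -> U y /\ `|'D_w f x - 'D_w f y| <= e / 2.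
  have /nbhs_ballP[r r0 hr] : \forall y \near x, U y /\ `|'D_w f x - 'D_w f y| <= e / 2.
    near=> y; split; first by near: y.
    by near: y; move/cvgrPdist_le : cw; exact.
  by exists r => // y yx; apply: hr; rewrite -ball_normE /= distrC.
near=> h.
have h0 : h != 0 by near: h; exact: nbhs_dnbhs_neq.
have hv : `|h| * (`|v| + `|w|) < r.
  have c0 : 0 < `|v| + `|w| + 1 by rewrite ltr_wpDl// addr_ge0.
  have : `|h| < r / (`|v| + `|w| + 1) by near: h; apply: dnbhs0_lt; rewrite divr_gt0.
  rewrite ltr_pdivlMr//; apply: le_lt_trans.
  by rewrite ler_wpM2l// lerDl.
have inb (t : R) : 0 <= t <= 1 -> `|x + h *: v + t *: (h *: w) - x| < r.
  move=> /andP[t0 t1]; apply: le_lt_trans hv.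
  rewrite addrC -addrA addKr mulrDr.
  apply: le_trans (ler_normD _ _) _; rewrite !normrZ lerD// ger0_norm//.
  by rewrite ler_piMl// mulr_ge0.
have [|t t01 E] := @MVT_line _ _ f (x + h *: v) (h *: w).
  by move=> t t01; have [Uy _] := hr _ (inb t t01); have [] := df _ Uy (h *: w).
have [Uy Dy] := hr _ (inb t t01).
have [dwy _] := df _ Uy w.
rewrite (deriveZdir _ dwy) in E.
have dv' : `|'D_v f x - h^-1 *: (f (h *: v + x) - f x)| <= e / 2.
  by near: h; move/cvgrPdist_le : dv; exact.
have -> : f (h *: (v + w) + x) - f x =
    h *: 'D_w f (x + h *: v + t *: (h *: w)) + (f (h *: v + x) - f x).
  by rewrite -E scalerDr (addrC (h *: v) x) (addrC _ x) addrA; ring.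
rewrite scalerDr [h^-1 *: (h *: _)]scalerA mulVf// scale1r.
set D := 'D_w f (_ + _) in Dy *; set q := h^-1 *: _ in dv' *.
have -> : 'D_v f x + 'D_w f x - (D + q) = ('D_v f x - q) + ('D_w f x - D) by ring.
by apply: le_trans (ler_normD _ _) _; rewrite [e]splitr lerD.
Unshelve. all: by end_near. Qed.

Lemma derive_sum_dir (R : realType) (V : normedModType R) (U : set V) (f : V -> R) x
    (I : Type) (r : seq I) (c : I -> R) (b : I -> V) :
  C1_on U f -> U x ->
  'D_(\sum_(i <- r) c i *: b i) f x = \sum_(i <- r) c i * 'D_(b i) f x.
Proof.
move=> fC Ux; elim: r => [|i r IH]; first by rewrite !big_nil derive0.
rewrite !big_cons (derive_addr_dir _ _ fC Ux) IH deriveZdir//.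
by have [_ /(_ x Ux (b i))[]] := fC.
Qed.

(* [b] and [co] play the role of a finite basis and its coordinates; abstracting
   them covers both ['rV_n] and ['rV_n * R]. *)
Lemma strict_diff_near (R : realType) (V : normedModType R) (I : finType)
    (b : I -> V) (co : V -> I -> R) (U : set V) (f : V -> R) x (e : R) :
  (forall v, v = \sum_i co v i *: b i) -> (forall v i, `|co v i| <= `|v|) ->
  C1_on U f -> U x -> 0 < e ->
  exists2 r : R, 0 < r & forall y z, `|y - x| < r -> `|z - x| < r ->
    `|f y - f z - 'D_(y - z) f x| <= e * `|y - z|.
Proof.
move=> bco cole fC Ux e0; have [Uo df] := fC.
have U0 : \forall y \near x, U y by exact: open_nbhs_nbhs.
(* One share of the error per basis vector; the successor keeps [e'] positive when [I] is empty. *)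
pose e' := e / #|I|.+1%:R.
have e'0 : 0 < e' by rewrite divr_gt0.
have [r r0 hr] : exists2 r : R, 0 < r & forall y, `|y - x| < r ->
    U y /\ forall i, `|'D_(b i) f x - 'D_(b i) f y| <= e'.
  have /nbhs_ballP[r r0 hr] : \forall y \near x, U y /\ forall i, `|'D_(b i) f x - 'D_(b i) f y| <= e'.
    near=> y; split; first by near: y.
    near: y; apply: filter_forall => i.
    by have [_ /cvgrPdist_le] := df x Ux (b i); exact.
  by exists r => // y yx; apply: hr; rewrite -ball_normE /= distrC.
exists r => // y z yx zx.
have inb (t : R) : 0 <= t <= 1 -> `|z + t *: (y - z) - x| < r.
  move=> /andP[t0 t1].
  have -> : z + t *: (y - z) - x = (1 - t) *: (z - x) + t *: (y - x).
    have -> : y - z = (y - x) - (z - x) by rewrite opprB addrA subrK.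
    by rewrite addrAC scalerBl scale1r (scalerBr t (y - x)) addrA addrAC.
  apply: le_lt_trans (ler_normD _ _) _; rewrite !normrZ.
  rewrite (ger0_norm t0) ger0_norm ?subr_ge0//.
  have [->|t1'] := eqVneq t 1.
    by rewrite subrr mul0r add0r mul1r.
  have t1'' : 0 < 1 - t by rewrite subr_gt0 lt_neqAle t1'.
  have : (1 - t) * `|z - x| < (1 - t) * r by rewrite ltr_pM2l.
  have : t * `|y - x| <= t * r by rewrite ler_wpM2l// ltW.
  lra.
have [|t t01 E] := @MVT_line _ _ f z (y - z).
  by move=> t /inb t01; have [Uy _] := hr _ t01; have [] := df _ Uy (y - z).
have [Uy Dy] := hr _ (inb t t01).
rewrite subrKC in E; rewrite E; set p := z + _ in Uy Dy *.
rewrite {1 2}[y - z]bco (derive_sum_dir _ _ _ fC Uy) (derive_sum_dir _ _ _ fC Ux) -sumrB.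
apply: le_trans (ler_norm_sum _ _ _) _.
have : \sum_(i : I) `|co (y - z) i * 'D_(b i) f p - co (y - z) i * 'D_(b i) f x|
   <= \sum_(i : I) `|y - z| * e'.
  apply: ler_sum => i _; rewrite -mulrBr normrM ler_pM// distrC; exact: Dy.
move=> /le_trans; apply.
have eI : e' * #|I|%:R <= e.
  by rewrite /e' mulrAC ler_pdivrMr// ler_wpM2l ?(ltW e0)// ler_nat.
rewrite sumr_const -mulr_natr -mulrA mulrC ler_wpM2r//.
Unshelve. all: by end_near. Qed.

Lemma C1_rowP (R : realType) (V : normedModType R) m (U : set V) (f : V -> 'rV[R]_m) x :
  C1_on U f -> U x ->
  (forall v w, 'D_(v + w) f x = 'D_v f x + 'D_w f x) /\
  (forall (I : Type) (r : seq I) (c : I -> R) (b : I -> V),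
     'D_(\sum_(i <- r) c i *: b i) f x = \sum_(i <- r) c i *: 'D_(b i) f x).
Proof.
move=> fC Ux; split=> [v w|I r c b]; apply/rowP => j; have [fCj E] := C1_on_coord 0 j fC.
  by rewrite -E// (derive_addr_dir _ _ fCj Ux) !E// mxE.
rewrite -E// (derive_sum_dir _ _ _ fCj Ux) summxE.
by apply: eq_bigr => i _; rewrite E// mxE.
Qed.

Lemma mx_norm_le (R : realType) m n (A : 'M[R]_(m, n)) (e : R) : 0 <= e ->
  (forall i j, `|A i j| <= e) -> `|A| <= e.
Proof.
by move=> e0 Ae; rewrite [leLHS]/Num.Def.normr/= mx_normrE bigmax_le// => -[i j] _.
Qed.

Lemma strict_diff_row (R : realType) (V : normedModType R) (I : finType)
    (b : I -> V) (co : V -> I -> R) (U : set V) m (f : V -> 'rV[R]_m) x (e : R) :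
  (forall v, v = \sum_i co v i *: b i) -> (forall v i, `|co v i| <= `|v|) ->
  C1_on U f -> U x -> 0 < e ->
  exists2 r : R, 0 < r & forall y z, `|y - x| < r -> `|z - x| < r ->
    `|f y - f z - 'D_(y - z) f x| <= e * `|y - z|.
Proof.
move=> bco cole fC Ux e0.
have /fin_all_exists2[r r0 hr] (j : 'I_m) := strict_diff_near bco cole (C1_on_coord 0 j fC).1 Ux e0.
exists (\big[Order.min/1]_j r j); first exact: lt_bigmin.
move=> y z yx zx; apply: mx_norm_le => [|i j]; first by rewrite mulr_ge0// ltW.
rewrite (ord1 i) !mxE -(C1_on_coord 0 j fC).2//.
by apply: hr; [apply: lt_le_trans yx _|apply: lt_le_trans zx _]; exact: bigmin_le.
Qed.

Lemma coord_le_norm (R : realType) n (v : 'rV[R]_n) i : `|v 0 i| <= `|v|.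
Proof.
by rewrite [leRHS]/Num.Def.normr/= mx_normrE (le_bigmax _ (fun ij => `|v ij.1 ij.2|) (0, i)).
Qed.

(** Index 0 is the time direction, the other indices are the spatial ones; this is the basis of
    space-time fed to [strict_diff_row]. *)
Definition joint_basis (R : realType) n (i : 'I_n.+1) : 'rV[R]_n * R :=
  if unlift ord0 i is Some j then (delta_mx 0 j, 0) else (0, 1).

Definition joint_coord (R : realType) n (v : 'rV[R]_n * R) (i : 'I_n.+1) : R :=
  if unlift ord0 i is Some j then v.1 0 j else v.2.

Lemma joint_basisP (R : realType) n (v : 'rV[R]_n * R) :
  v = \sum_i joint_coord v i *: joint_basis R i.
Proof.
rewrite big_ord_recl /joint_coord /joint_basis unlift_none.
under eq_bigr do rewrite liftK.
have -> : \sum_(i < n) v.1 0 i *: (delta_mx 0 i, 0 : R) = (v.1, 0) :> 'rV[R]_n * R.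
  rewrite [in RHS](row_sum_delta v.1).
  rewrite (big_morph (fun w : 'rV[R]_n => (w, 0 : R)) (id1 := 0) (op1 := +%R)) //.
    by apply: eq_bigr => i _; congr pair; rewrite /= scaler0.
  by move=> x y; congr pair; rewrite addr0.
case: v => u t; congr pair => /=; first by rewrite scaler0 add0r.
by rewrite addr0 [_ *: 1]mulr1.
Qed.

Lemma joint_coord_le (R : realType) n (v : 'rV[R]_n * R) i : `|joint_coord v i| <= `|v|.
Proof.
rewrite /joint_coord; case: unliftP => [j _|_]; rewrite prod_normE /= le_max.
  by rewrite coord_le_norm.
by rewrite lexx orbT.
Qed.

(** With one of its two points fixed at [u], the estimate of [strict_diff_row] is the little-o
    expansion. The differential is needed because the Jacobian is defined from it. *)
Lemma C1_differentiable (R : realType) n m (U : set 'rV[R]_n) (X : 'rV[R]_n -> 'rV[R]_m) u :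
  C1_on U X -> U u -> differentiable X u.
Proof.
move=> XC Uu; pose J := \matrix_i 'D_(delta_mx 0 i) X u.
pose d (v : 'rV[R]_n) : 'rV[R]_m := v *m J.
have dE v : d v = 'D_v X u.
  rewrite [in RHS](row_sum_delta v) (C1_rowP XC Uu).2 /d mulmx_sum_row.
  by apply: eq_bigr => i _; rewrite rowK.
have lind : linear d by move=> a v w; rewrite /d mulmxDl -scalemxAl.
pose dM := GRing.isLinear.Build _ _ _ _ _ lind.
pose dL : {linear _ -> _} := HB.pack d dM.
have cd : continuous d.
  rewrite (_ : d = fun v => \sum_i v 0 i *: row i J); last first.
    by apply: funext => v; rewrite /d mulmx_sum_row.
  apply: continuous_big => [|i _ v]; first exact: add_continuous.
  have co : (fun w : 'rV[R]_n => w 0 i) @ v --> v 0 i by exact: coord_continuous.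
  exact: (cvgZr_tmp co).
have dX : X \o shift u = cst (X u) + d +o_ (0 : 'rV[R]_n) id.
  apply/eqaddoP => e e0; rewrite near_simpl.
  have [r r0 hr] := strict_diff_row (@row_sum_delta _ _) (@coord_le_norm _ _) XC Uu e0.
  near=> h; have := hr (h + u) u; rewrite subrr normr0 addrK => /(_ _ r0).
  rewrite -dE !fctE /= opprD addrA.
  apply; near: h; apply/nbhs_ballP; exists r => //= y.
  by rewrite -ball_normE /= sub0r normrN.
have dX' : 'd X u = d :> ('rV[R]_n -> 'rV[R]_m).
  exact: (@diff_unique _ _ _ X dL u cd dX).
by apply/diff_locallyP; rewrite dX'.
Unshelve. all: by end_near. Qed.

Lemma jacobian_C1 (R : realType) n m (U : set 'rV[R]_n) (X : 'rV[R]_n -> 'rV[R]_m) u w :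
  C1_on U X -> U u -> w *m 'J X u = 'D_w X u.
Proof. by move=> XC Uu; rewrite -deriveEjacobian//; exact: C1_differentiable XC Uu. Qed.

Lemma norm_mulmx_le (R : realType) n m (w : 'rV[R]_n) (K : 'M[R]_(n, m)) :
  `|w *m K| <= n%:R * `|K| * `|w|.
Proof.
apply: mx_norm_le => [|i j]; first by rewrite !mulr_ge0.
rewrite mxE; apply: le_trans (ler_norm_sum _ _ _) _.
rewrite -[n in n%:R]card_ord -sum1_card natr_sum -mulrA mulr_suml.
apply: ler_sum => k _; rewrite mul1r normrM mulrC (ord1 i) ler_pM//; last exact: coord_le_norm.
by rewrite [leRHS]/Num.Def.normr/= mx_normrE (le_bigmax _ (fun ij => `|K ij.1 ij.2|) (k, j)).
Qed.

(** A right inverse of [J] recovers [w] from [w *m J], so its norm controls the constant. *)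
Lemma row_free_lower_bound (R : realType) n m (J : 'M[R]_(n, m)) : row_free J ->
  exists2 c : R, 0 < c & forall w : 'rV[R]_n, c * `|w| <= `|w *m J|.
Proof.
move=> /row_freeP[K JK].
pose C := m%:R * `|K| + 1.
have C0 : 0 < C by rewrite ltr_wpDl// mulr_ge0.
exists C^-1; first by rewrite invr_gt0.
move=> w; rewrite mulrC ler_pdivrMr//.
rewrite -{1}[w]mulmx1 -JK mulmxA; apply: le_trans (norm_mulmx_le _ _) _.
by rewrite mulrC ler_wpM2l// /C lerDl.
Qed.

Lemma is_derive_near (R : realType) (W : normedModType R) (f : R -> W) (t : R) df (e : R) :
  is_derive t (1 : R) f df -> 0 < e ->
  exists2 d : R, 0 < d & forall h, `|h| < d -> `|f (t + h) - f t - h *: df| <= e * `|h|.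
Proof.
move=> [dft dfE] e0.
have /cvgrPdist_le/(_ e e0) : (fun h => h^-1 *: ((f \o shift t) (h *: 1) - f t)) @ 0^' --> df.
  by rewrite -dfE.
rewrite /dnbhs /= => /nbhs_ballP[d /= d0 hd]; exists d => // h hd'.
have [->|h0] := eqVneq h 0; first by rewrite addr0 subrr scale0r subr0 !normr0 mulr0.
have := hd h; rewrite -ball_normE /= sub0r normrN => /(_ hd' h0).
rewrite [h *: 1]mulr1 (addrC h) => hq.
have -> : f (t + h) - f t - h *: df = - h *: (df - h^-1 *: (f (t + h) - f t)).
  by rewrite scalerBr !scaleNr opprK scalerA divff// scale1r addrC.
by rewrite normrZ normrN mulrC ler_wpM2r.
Qed.

Lemma enorm1_norm_le1 (R : realType) m (u : 'rV[R]_m) : enorm u = 1 -> `|u| <= 1.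
Proof. by move=> <-; exact: norm_le_enorm. Qed.

(* The tangent plane is a first-order approximation of the whole embedded image, not only
   of a coordinate patch. *)
Lemma embedding_near_tangent (R : realType) n m (M : topologicalType)
    (A : set (chart R n M)) (f : M -> 'rV[R]_m) c p nu (e : R) :
  smooth_embedding A f -> A c -> chart_dom c p -> enorm nu = 1 ->
  'J (local_rep f c) (chart_fun c p) *m nu^T = 0 -> 0 < e ->
  exists2 r : R, 0 < r & forall q, `|f q - f p| < r ->
    `|dot (f q - f p) nu| <= e * `|f q - f p|.
Proof.
move=> femb Ac cp nu1 Jnu e0.
set X := local_rep f c; set u0 := chart_fun c p in Jnu *.
have XC : C1_on (chart_cod c) X.
  by apply: smooth_on_C1; [exact: chart_cod_open|exact: (embedding_smooth femb Ac)].
have u0c : chart_cod c u0 by exact: chart_funS.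
have [k k0 hk] := row_free_lower_bound (embedding_immersion femb Ac cp).
rewrite -/X -/u0 in hk.
have m1 : 0 < m.+1%:R :> R by [].
(* The bound [k / 2] lets the linearisation error be absorbed, giving k/2 |v - u0| <= |D|. The
   second bound then turns that error, multiplied by the dimension factor of [norm_dot_le], into [e]
   times |D|. *)
pose e1 := Order.min (k / 2) (e * k / 2 / m.+1%:R).
have e10 : 0 < e1 by rewrite lt_min !divr_gt0// mulr_gt0.
have [r r0 hr] := strict_diff_row (@row_sum_delta _ _) (@coord_le_norm _ _) XC u0c e10.
pose U := chart_dom c `&` (chart_fun c @^-1` ball u0 r).
have Uo : open U.
  have := @chart_fun_continuous _ _ _ c.
  rewrite continuous_open_subspace; last exact: chart_dom_open.
  move=> cc; rewrite openE => q [cq qr]; rewrite /interior.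
  apply: filterI; first exact: open_nbhs_nbhs (conj (chart_dom_open c) cq).
  apply: cc; first by rewrite inE.
  by apply: open_nbhs_nbhs; split => //; exact: ball_open.
(* The embedding topology makes every point of the image close to [f p] come from the small chart
   neighbourhood, which rules out other sheets near [f p]. *)
have [V Vo UV] := embedding_topology femb Uo.
have Vp : V (f p).
  have : U p by split => //; exact: ballxx.
  by rewrite UV.
have /nbhs_ballP[r' r'0 hr'] : nbhs (f p) V by exact: open_nbhs_nbhs.
exists r' => // q fqp.
have [cq] : U q by rewrite UV; apply: hr'; rewrite -ball_normE /= distrC.
rewrite /preimage /= -ball_normE /= distrC; set v := chart_fun c q => vr.
have Xq : f q = X v by rewrite /X /local_rep /= chart_funK.
have Xp : f p = X u0 by rewrite /X /local_rep /= chart_funK.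
have /hr : `|v - u0| < r by [].
move=> /(_ u0); rewrite subrr normr0 => /(_ r0).
rewrite Xq Xp; set D := X v - X u0; rewrite -(jacobian_C1 _ XC u0c).
set w := v - u0; set E := D - _ => hE.
have DE : D = w *m 'J X u0 + E by rewrite /E addrC subrK.
have dotD : dot D nu = dot E nu.
  by rewrite DE dotDl dot_mulmx -[nu *m _]trmxK trmx_mul trmxK Jnu trmx0 dotC dot0l add0r.
have kw : k * `|w| <= `|D| + e1 * `|w|.
  apply: le_trans (hk w) _.
  have -> : w *m 'J X u0 = D - E by rewrite DE addrK.
  by apply: le_trans (ler_normB _ _) _; rewrite lerD2l.
have e1k : e1 <= k / 2 by rewrite ge_min lexx.
have e1e : e1 * m.+1%:R <= e * k / 2 by rewrite -ler_pdivlMr// ge_min lexx orbT.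
have w0 : 0 <= `|w| by [].
have kwD : k / 2 * `|w| <= `|D|.
  have : e1 * `|w| <= k / 2 * `|w| by rewrite ler_wpM2r.
  lra.
rewrite dotD; apply: le_trans (norm_dot_le _ _) _.
have nu_le := enorm1_norm_le1 nu1.
have s1 : m%:R * (`|E| * `|nu|) <= m.+1%:R * (e1 * `|w|).
  rewrite ler_pM ?mulr_ge0// ?ler_nat//.
  by rewrite -[leRHS]mulr1 ler_pM.
apply: le_trans s1 _.
rewrite mulrA (mulrC m.+1%:R).
have : e1 * m.+1%:R * `|w| <= e * k / 2 * `|w| by rewrite ler_wpM2r.
move=> /le_trans; apply.
have : e * (k / 2 * `|w|) <= e * `|D| by rewrite ler_wpM2l// ltW.
by apply: le_trans; rewrite !mulrA.
Qed.

Lemma open_itv_open (R : realType) (T0 T1 : \bar R) : open (open_itv T0 T1).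
Proof.
have -> : open_itv T0 T1 = [set t | (T0 < t%:E)%E] `&` [set t | (t%:E < T1)%E].
  by apply/seteqP; split=> t /=; rewrite /open_itv/= => /andP.
by apply: openI; [exact: open_ereal_gt|exact: open_ereal_lt].
Qed.

Lemma open_itv_convex (R : realType) (T0 T1 : \bar R) s t u :
  open_itv T0 T1 s -> open_itv T0 T1 t -> s <= u <= t -> open_itv T0 T1 u.
Proof.
rewrite /open_itv /= => /andP[s0 _] /andP[_ t1] /andP[su ut].
by rewrite (lt_le_trans s0) ?lee_fin//= (le_lt_trans _ t1)// lee_fin.
Qed.

(** A directional derivative sees only the restriction to a line. This is used to pass between
    space-time charts, time slices and trajectories of single points. *)
Lemma derive_along (R : realType) (V V' W : normedModType R) (f : V -> W) (g : V' -> W) x v x' v' :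
  (forall h : R, f (h *: v + x) = g (h *: v' + x')) ->
  'D_v f x = 'D_v' g x' /\ (derivable f x v -> derivable g x' v').
Proof.
move=> fg; have e : (fun h : R => h^-1 *: ((f \o shift x) (h *: v) - f x)) =
    (fun h : R => h^-1 *: ((g \o shift x') (h *: v') - g x')).
  apply: funext => h /=; rewrite fg; congr (_ *: (_ - _)).
  by have := fg 0; rewrite !scale0r !add0r.
by rewrite /derive /derivable e.
Qed.

(** * Monotonicity of symmetric functions of eigenvalues *)

Lemma posdef_unitmx (R : realType) n (I : 'M[R]_n) :
  (forall v : 'rV_n, v != 0 -> 0 < (v *m I *m v^T) 0 0) -> I \in unitmx.
Proof.
move=> Ipos; rewrite -row_free_unit -kermx_eq0; apply/rowV0P => v /sub_kermxP vI.
apply/eqP/negPn/negP => /Ipos; by rewrite vI mul0mx mxE ltxx.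
Qed.

Lemma ex_row_free_ortho (R : realType) n (u : 'cV[R]_n.+1) : u != 0 ->
  exists2 N : 'M[R]_(n, n.+1), row_free N & N *m u = 0.
Proof.
move=> u0.
have rk : \rank (kermx u) = n.
  rewrite mxrank_ker (_ : \rank u = 1%N) ?subn1//.
  by apply/eqP; rewrite eqn_leq rank_leq_col lt0n mxrank_eq0.
have : exists2 N : 'M[R]_(\rank (kermx u), n.+1), row_free N & N *m u = 0.
  exists (row_base (kermx u)); first exact: row_base_free.
  by apply/sub_kermxP; rewrite eq_row_base.
by rewrite rk.
Qed.

Lemma char_poly_conj (R : realType) n (P S : 'M[R]_n) : P \in unitmx ->
  char_poly (P *m S *m invmx P) = char_poly S.
Proof.
move=> Pu; rewrite /char_poly /char_poly_mx.
have -> : 'X%:M - map_mx polyC (P *m S *m invmx P) =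
   map_mx polyC P *m ('X%:M - map_mx polyC S) *m map_mx polyC (invmx P).
  rewrite mulmxBr mulmxBl -!map_mxM /=; congr (_ - _).
  by rewrite scalar_mxC -mulmxA -map_mxM mulmxV// map_mx1 mulmx1.
rewrite !det_mulmx mulrAC -det_mulmx -map_mxM mulmxV// map_mx1 det1 mul1r//.
Qed.

Lemma char_poly_block_diag (R : realType) n (a : R) (S : 'M[R]_n) :
  char_poly (block_mx (a%:M : 'M[R]_1) 0 0 S) = ('X - a%:P) * char_poly S.
Proof.
rewrite /char_poly /char_poly_mx scalar_mx_block map_block_mx opp_block_mx add_block_mx.
rewrite !map_mx0 !oppr0 !addr0 det_ublock map_scalar_mx /=.
by rewrite -raddfB /= det_scalar1.
Qed.

Lemma prod_polyXsubC_rshift (R : realType) n (lam : 'rV[R]_n.+1) :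
  \prod_(i < n.+1) ('X - (lam 0 i)%:P) =
  ('X - (lam 0 0)%:P) * \prod_(i < n) ('X - ((\row_j lam 0 (lift 0 j)) 0 i)%:P).
Proof. by rewrite big_ord_recl; congr (_ * _); apply: eq_bigr => i _; rewrite mxE. Qed.

(** Simultaneous diagonalisation by deflation: an eigenvector of unit [I]-length is split off, and
    both forms restrict to its [I]-orthogonal complement. That the eigenvalues are real, and their
    order, come with the factorised characteristic polynomial. *)
Lemma pencil_diag (R : realType) n (A I : 'M[R]_n) (lam : 'rV[R]_n) :
  A^T = A -> I^T = I -> (forall v : 'rV_n, v != 0 -> 0 < (v *m I *m v^T) 0 0) ->
  char_poly (A *m invmx I) = \prod_(i < n) ('X - (lam 0 i)%:P) ->
  exists P : 'M[R]_n, P *m I *m P^T = 1%:M /\ P *m A *m P^T = diag_mx lam.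
Proof.
elim: n => [|n IH] in A I lam *.
  by move=> *; exists 1%:M; split; apply/matrixP => -[].
move=> At It Ipos chA.
have Iu := posdef_unitmx Ipos.
have : eigenvalue (A *m invmx I) (lam 0 0).
  by rewrite eigenvalue_root_char chA rootE prod_polyXsubC_rshift hornerM hornerXsubC subrr mul0r.
move=> /eigenvalueP[v0 v0A v0n0].
pose v : 'rV[R]_n.+1 := (Num.sqrt ((v0 *m I *m v0^T) 0 0))^-1 *: v0.
have v0I := Ipos _ v0n0.
have vA : v *m A = lam 0 0 *: (v *m I).
  rewrite -{1}[A](mulmxKV Iu) mulmxA /v -(scalemxAl _ v0 (A *m _)) v0A.
  by rewrite -!scalemxAl !scalerA mulrC.
have vIv : v *m I *m v^T = 1%:M.
  rewrite [LHS]mx11_scalar (_ : _ 0 0 = 1)// /v.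
  rewrite linearZ /= -scalemxAr -!scalemxAl; move: v0I.
  set q := v0 *m I *m v0^T => q0.
  by rewrite scalerA mxE -invfM -expr2 sqr_sqrtr ?ltW// mulVf// gt_eqF.
have vIn0 : I *m v^T != 0.
  apply/eqP => vI0; move: vIv; rewrite -mulmxA vI0 mulmx0 => /matrixP/(_ 0 0)/eqP.
  by rewrite !mxE eqxx eq_sym oner_eq0.
(* The rows of [N] are a basis of the [I]-orthogonal complement of [v]; they are also [A]-orthogonal
   to [v], since [v *m A] is proportional to [v *m I]. *)
have [N Nfree NI] := ex_row_free_ortho vIn0.
have NI' : v *m I *m N^T = 0 by apply: trmx_inj; rewrite !trmx_mul trmxK It trmx0.
pose I' := N *m I *m N^T; pose A' := N *m A *m N^T.
have It' : I'^T = I' by rewrite /I' !trmx_mul trmxK It mulmxA.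
have At' : A'^T = A' by rewrite /A' !trmx_mul trmxK At mulmxA.
have Ipos' (w : 'rV_n) : w != 0 -> 0 < (w *m I' *m w^T) 0 0.
  move=> w0; have : w *m N != 0 by rewrite mulmx_free_eq0.
  by move=> /Ipos; rewrite trmx_mul /I' !mulmxA.
have Iu' := posdef_unitmx Ipos'.
pose P0 : 'M[R]_(1 + n) := col_mx v N.
have P0I : P0 *m (I : 'M[R]_(1 + n)) *m P0^T = block_mx 1%:M 0 0 I'.
  rewrite /P0 tr_col_mx mul_col_mx mul_col_row.
  congr block_mx; [exact: vIv|exact: NI'|rewrite -mulmxA; exact: NI].
have P0A : P0 *m (A : 'M[R]_(1 + n)) *m P0^T = block_mx (lam 0 0)%:M 0 0 A'.
  rewrite /P0 tr_col_mx mul_col_mx mul_col_row.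
  have vAN : v *m A *m N^T = 0 by rewrite vA -scalemxAl NI' scaler0.
  congr block_mx; [|exact: vAN|].
    by have := congr1 (mulmx^~ v^T) vA; rewrite -scalemxAl vIv scalemx1.
  by apply: trmx_inj; rewrite !trmx_mul trmxK At mulmxA trmx0; exact: vAN.
have P0u : P0 \in unitmx.
  have : P0 *m (I : 'M[R]_(1 + n)) *m P0^T \in unitmx.
    by rewrite P0I unitmxE det_ublock det1 mul1r -unitmxE.
  by rewrite !unitmx_mul => /andP[/andP[]].
have chA' : char_poly (A' *m invmx I') =
    \prod_(i < n) ('X - ((\row_j lam 0 (lift 0 j)) 0 i)%:P).
  (* In the block basis the characteristic polynomial is X - lam_0 times that of the restricted
     pencil; cancelling this factor leaves the roots required by the induction hypothesis. *)
  apply: (mulfI (negbT (polyXsubC_eq0 (lam 0 0)))).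
  rewrite -prod_polyXsubC_rshift -chA -char_poly_block_diag.
  apply: etrans (char_poly_conj (A *m invmx I) P0u); congr char_poly.
  have -> : P0 *m (A *m invmx I) *m invmx P0 =
     (P0 *m A *m P0^T) *m invmx (P0 *m I *m P0^T).
    have PIPu : P0 *m I *m P0^T \in unitmx by rewrite !unitmx_mul P0u Iu unitmx_tr.
    apply: (can_inj (mulmxK PIPu)); rewrite (mulmxKV PIPu) !mulmxA.
    by rewrite (mulmxKV P0u) (mulmxKV Iu).
  rewrite P0A P0I invmx_block_diag ?block_diag_mx_unit ?unitmx1//.
  by rewrite mulmx_block !(mulmx0, mul0mx, add0r, addr0) invmx1 mulmx1.

have [P' [P'I P'A]] := IH _ _ _ At' It' Ipos' chA'.
pose B : 'M[R]_(1 + n) := block_mx 1%:M 0 0 P'.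
have PE (X : 'M[R]_(1 + n)) : (B *m P0) *m X *m (B *m P0)^T = B *m (P0 *m X *m P0^T) *m B^T.
  by rewrite trmx_mul !mulmxA.
exists (B *m P0); split.
  apply: (etrans (PE I)); rewrite P0I /B tr_block_mx !mulmx_block.
  rewrite !(mulmx0, mul0mx, add0r, addr0, trmx0, trmx1, mulmx1, mul1mx).
  by rewrite P'I -scalar_mx_block.
apply: (etrans (PE A)); rewrite P0A /B tr_block_mx !mulmx_block.
rewrite !(mulmx0, mul0mx, add0r, addr0, trmx0, trmx1, mulmx1, mul1mx).
rewrite P'A; apply: etrans (congr1 (@diag_mx R (1 + n)) (hsubmxK (lam : 'rV_(1 + n)))).
rewrite diag_mx_row; congr (block_mx _ _ _ _).
  by apply/matrixP => i j; rewrite !mxE !ord1 lshift0.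
by congr diag_mx; apply/rowP => j; rewrite !mxE rshift1.
Qed.

Lemma ex_sort_perm (R : realType) n (lam : 'rV[R]_n) :
  exists s : 'S_n, forall i j : 'I_n, (i <= j)%N -> lam 0 (s i) <= lam 0 (s j).
Proof.
pose t := [tuple lam 0 i | i < n].
have [s Hs] : exists s : 'S_n, sort <=%R t = [tuple tnth t (s i) | i < n].
  by apply/tuple_permP; rewrite perm_sort.
exists s => i j ij.
have nthE (k : 'I_n) : lam 0 (s k) = nth 0 (sort <=%R t) k.
  by rewrite Hs -tnth_nth tnth_mktuple tnth_mktuple.
rewrite !nthE; apply: (sorted_leq_nth le_trans lexx) => //.
- exact: sort_le_sorted.
- by rewrite inE size_sort size_tuple.
- by rewrite inE size_sort size_tuple.
Qed.

Lemma mx11_diag_form (R : realType) n (a d : 'rV[R]_n) :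
  (a *m diag_mx d *m a^T) 0 0 = \sum_i d 0 i * a 0 i ^+ 2.
Proof.
rewrite mxE; apply: eq_bigr => i _; rewrite mul_mx_diag !mxE expr2; ring.
Qed.

(** The rows of [P] are eigenvectors of the pencil, so both forms are diagonal on the span of any
    selection of them. *)
Lemma rowsub_pencil (R : realType) n k (f : 'I_k -> 'I_n) (P I A : 'M[R]_n)
    (lam : 'rV[R]_n) (a : 'rV[R]_k) : injective f ->
  P *m I *m P^T = 1%:M -> P *m A *m P^T = diag_mx lam ->
  let w := a *m rowsub f P in
  (w *m I *m w^T) 0 0 = \sum_i a 0 i ^+ 2 /\
  (w *m A *m w^T) 0 0 = \sum_i lam 0 (f i) * a 0 i ^+ 2.
Proof.
move=> finj PI PA w.
have form B (d : 'rV[R]_n) : P *m B *m P^T = diag_mx d ->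
    (w *m B *m w^T) 0 0 = \sum_i d 0 (f i) * a 0 i ^+ 2.
  move=> PB; rewrite (_ : \sum_i _ = (a *m diag_mx (\row_i d 0 (f i)) *m a^T) 0 0).
    have -> : w *m B *m w^T = a *m (rowsub f P *m B *m (rowsub f P)^T) *m a^T.
      by rewrite /w trmx_mul !mulmxA.
    have -> : rowsub f P *m B *m (rowsub f P)^T = mxsub f f (P *m B *m P^T).
      apply/matrixP => i j; rewrite !mxE; apply: eq_bigr => k' _.
      by rewrite !mxE; congr (_ * _); apply: eq_bigr => l _; rewrite mxE.
    congr ((_ *m _ *m _) 0 0).
    rewrite PB; apply/matrixP => i j; rewrite !mxE (inj_eq finj).
    by case: eqP => [->|].
  by rewrite mx11_diag_form; apply: eq_bigr => i _; rewrite mxE.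
split; last exact: form.
rewrite (form I (const_mx 1)) ?PI; last by rewrite diag_const_mx.
by apply: eq_bigr => i _; rewrite mxE mul1r.
Qed.

(** Courant-Fischer by counting dimensions: the span of the [k + 1] lowest eigenvectors of [A1]
    meets that of the [n - k] highest of [A2]. On a common vector, [mu] at rank [k] bounds [A2] from
    below and [lam] at rank [k] bounds [A1] from above. *)
Lemma pencil_eigen_le (R : realType) n (A1 A2 I P Q : 'M[R]_n)
    (lam mu : 'rV[R]_n) (s1 s2 : 'S_n) :
  P *m I *m P^T = 1%:M -> P *m A1 *m P^T = diag_mx lam ->
  Q *m I *m Q^T = 1%:M -> Q *m A2 *m Q^T = diag_mx mu ->
  (forall w : 'rV_n, (w *m A2 *m w^T) 0 0 <= (w *m A1 *m w^T) 0 0) ->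
  (forall i j : 'I_n, (i <= j)%N -> lam 0 (s1 i) <= lam 0 (s1 j)) ->
  (forall i j : 'I_n, (i <= j)%N -> mu 0 (s2 i) <= mu 0 (s2 j)) ->
  forall k, mu 0 (s2 k) <= lam 0 (s1 k).
Proof.
move=> PI PA QI QA le21 ss1 ss2 k.
pose f (i : 'I_k.+1) := s1 (widen_ord (ltn_ord k) i).
have kn : (k + (n - k) = n)%N by rewrite subnKC// ltnW.
pose g (j : 'I_(n - k)) := s2 (cast_ord kn (rshift k j)).
have finj : injective f by move=> i j /perm_inj/(congr1 val)/= ?; exact: val_inj.
have ginj : injective g.
  by move=> i j /perm_inj/(congr1 val)/= /addnI ?; exact: val_inj.
(* There are n + 1 rows in dimension n; a linear relation between them is a common vector of the two
   spans. *)
have : kermx (col_mx (rowsub f P) (rowsub g Q)) != 0.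
  rewrite kermx_eq0 /row_free neq_ltn; apply/orP; left.
  by apply: leq_ltn_trans (rank_leq_col _) _; rewrite addSn kn.
move=> /rowV0Pn[v /sub_kermxP]; rewrite -[v]hsubmxK mul_row_col.
set a := lsubmx v; set b := rsubmx v => /eqP; rewrite addr_eq0 => /eqP abE v0.
have [wI wA] := rowsub_pencil a finj PI PA.
have [wI' wA'] := rowsub_pencil (- b) ginj QI QA.
rewrite mulNmx -abE in wI' wA'.
have ab : \sum_i a 0 i ^+ 2 = \sum_i (- b) 0 i ^+ 2 by rewrite -wI -wI'.
have a_gt0 : 0 < \sum_i a 0 i ^+ 2.
  have dotsum m (u : 'rV[R]_m) : \sum_i u 0 i ^+ 2 = dot u u.
    by apply: eq_bigr => i _; rewrite expr2.
  rewrite dotsum dot_gt0; apply: contraNneq v0 => a0.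
  move: ab; rewrite !dotsum a0 dot0l => /esym/eqP; rewrite dot_eq0 oppr_eq0 => /eqP ->.
  by rewrite row_mx0.
have h1 : (a *m rowsub f P *m A1 *m (a *m rowsub f P)^T) 0 0
    <= lam 0 (s1 k) * \sum_i a 0 i ^+ 2.
  rewrite wA mulr_sumr; apply: ler_sum => i _; rewrite ler_wpM2r ?sqr_ge0//.
  by apply: ss1; rewrite /= -ltnS.
have h2 : mu 0 (s2 k) * \sum_i a 0 i ^+ 2 <=
    (a *m rowsub f P *m A2 *m (a *m rowsub f P)^T) 0 0.
  rewrite wA' ab mulr_sumr; apply: ler_sum => i _; rewrite ler_wpM2r ?sqr_ge0//.
  by apply: ss2; rewrite /= leq_addr.
rewrite -(ler_pM2r a_gt0); apply: le_trans h2 _; exact: le_trans (le21 _) h1.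
Qed.

(** Symmetry of [F] allows both spectra to be sorted, after which they are comparable entry by
    entry. *)
Lemma symmetric_fun_pencil_le (R : realType) n (G : set 'rV[R]_n) (F : 'rV[R]_n -> R)
    (A1 A2 I : 'M[R]_n) (lam mu : 'rV[R]_n) :
  symmetric_set G -> symmetric_fun_on G F ->
  (forall x z, G x -> G z -> (forall i, x 0 i <= z 0 i) -> F x <= F z) ->
  A1^T = A1 -> A2^T = A2 -> I^T = I ->
  (forall v : 'rV_n, v != 0 -> 0 < (v *m I *m v^T) 0 0) ->
  char_poly (A1 *m invmx I) = \prod_(i < n) ('X - (lam 0 i)%:P) ->
  char_poly (A2 *m invmx I) = \prod_(i < n) ('X - (mu 0 i)%:P) ->
  (forall w : 'rV_n, (w *m A2 *m w^T) 0 0 <= (w *m A1 *m w^T) 0 0) ->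
  G lam -> G mu -> F mu <= F lam.
Proof.
move=> Gs Fs Fm A1t A2t It Ipos ch1 ch2 le21 Glam Gmu.
have [P [PI PA]] := pencil_diag A1t It Ipos ch1.
have [Q [QI QA]] := pencil_diag A2t It Ipos ch2.
have [s1 ss1] := ex_sort_perm lam; have [s2 ss2] := ex_sort_perm mu.
rewrite -(Fs s1 lam Glam) -(Fs s2 mu Gmu).
apply: Fm => [||i]; [exact: Gs|exact: Gs|rewrite !mxE].
exact: pencil_eigen_le PI PA QI QA le21 ss1 ss2 i.
Qed.

(** * Contact of two hypersurfaces *)

Lemma is_derive_mul (R : realType) (f g : R -> R) (t df dg : R) :
  is_derive t (1 : R) f df -> is_derive t (1 : R) g dg ->
  is_derive t (1 : R) (fun s => f s * g s) (df * g t + f t * dg).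
Proof.
move=> hf hg; apply: (@is_derive_eq _ _ _ (f * g) _ _ _ _ (is_deriveM hf hg)).
by rewrite /GRing.scale /= addrC (mulrC (g t)).
Qed.

Lemma is_derive_dot (R : realType) m (f g : R -> 'rV[R]_m) (t : R) df dg :
  is_derive t (1 : R) f df -> is_derive t (1 : R) g dg ->
  is_derive t (1 : R) (fun s => dot (f s) (g s)) (dot df (g t) + dot (f t) dg).
Proof.
have coord (h : R -> 'rV[R]_m) dh i : is_derive t (1 : R) h dh ->
    is_derive t (1 : R) (fun s => h s 0 i) (dh 0 i).
  move=> [ht hE]; split; first by move/derivable_mxP : ht; exact.
  by move: hE; rewrite derive_mx// => <-; rewrite mxE.
move=> hf hg.
have := is_derive_sum (fun i => is_derive_mul (coord _ _ i hf) (coord _ _ i hg)).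
rewrite big_split /=; congr is_derive.
by apply: funext => s; rewrite fct_sumE.
Qed.

Lemma is_derive_sub_cst (R : realType) (V : normedModType R) (f : R -> V) (t : R) df c :
  is_derive t (1 : R) f df -> is_derive t (1 : R) (fun s => f s - c) df.
Proof.
move=> hf; have := is_deriveB hf (is_derive_cst c t (1 : R)).
by rewrite subr0.
Qed.

Lemma is_derive_sub (R : realType) (V : normedModType R) (f g : R -> V) (t : R) df dg :
  is_derive t (1 : R) f df -> is_derive t (1 : R) g dg ->
  is_derive t (1 : R) (fun s => f s - g s) (df - dg).
Proof. by move=> hf hg; apply: (is_deriveB hf hg). Qed.

Lemma left_max_derive_ge0 (R : realType) (K : R -> R) (t k d : R) :
  is_derive t (1 : R) K k -> 0 < d ->
  (forall h, 0 < h < d -> K (t - h) <= K t) -> 0 <= k.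
Proof.
move=> hK d0 hmax; rewrite leNgt; apply/negP => k0.
have e0 : 0 < - k / 2 by rewrite divr_gt0// oppr_gt0.
have [r r0 hr] := is_derive_near hK e0.
pose h := Order.min (d / 2) (r / 2).
have h0 : 0 < h by rewrite lt_min !divr_gt0.
have hd : h < d by rewrite gt_min; apply/orP; left; lra.
have hr' : h < r by rewrite gt_min; apply/orP; right; lra.
have := hr (- h); rewrite normrN gtr0_norm// => /(_ hr').
have : K (t - h) <= K t by apply: hmax; rewrite h0.
rewrite ler_norml => hm /andP[h1 h2]; move: h1 h2; rewrite scaleNr (_ : h *: k = h * k)//.
have : 0 < h * (- k) by rewrite mulr_gt0// oppr_gt0.
lra.
Qed.

(** The first derivative need only be differentiable at 0: if [k2] were positive, [K1] would be
    positive just to the right of 0 and the mean value theorem would push [K] above [K 0]. *)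
Lemma second_order_max (R : realType) (K K1 : R -> R) (k2 d : R) : 0 < d ->
  (forall t, `|t| < d -> is_derive t (1 : R) K (K1 t)) ->
  is_derive (0 : R) (1 : R) K1 k2 ->
  (forall t, `|t| < d -> K t <= K 0) -> K1 0 = 0 /\ k2 <= 0.
Proof.
move=> d0 hK hK1 hmax.
have K10 : K1 0 = 0.
  have h00 : 0 \in `]- d, d[ by rewrite in_itv /= oppr_lt0 d0.
  have hK0 : is_derive (0 : R) (1 : R) K (K1 0) by apply: hK; rewrite normr0.
  have dd : - d <= d by lra.
  have dK t : t \in `]- d, d[ -> derivable K t 1.
    by rewrite in_itv /= -ltr_norml => td; have [] := hK t td.
  have mK t : t \in `]- d, d[ -> K t <= K 0.
    by rewrite in_itv /= -ltr_norml => td; exact: hmax.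
  have [_ E] := derive1_at_max dd dK h00 mK.
  by have [_ <-] := hK0.
split => //; rewrite leNgt; apply/negP => k20.
have e0 : 0 < k2 / 2 by rewrite divr_gt0.
have [r r0 hr] := is_derive_near hK1 e0.
pose h := Order.min (d / 2) (r / 2).
have h0 : 0 < h by rewrite lt_min !divr_gt0.
have hd : h < d by rewrite gt_min; apply/orP; left; lra.
have hr' : h < r by rewrite gt_min; apply/orP; right; lra.
have [||u] := @MVT _ K K1 0 h h0.
- move=> u; rewrite in_itv /= => /andP[u0 uh]; apply: hK.
  by rewrite gtr0_norm// (lt_trans uh).
- apply: derivable_within_continuous => u; rewrite in_itv /= => /andP[u0 uh].
  have ud : `|u| < d by rewrite ger0_norm// (le_lt_trans uh).
  by have [] := hK u ud.
rewrite in_itv /= subr0 => /andP[u0 uh] E.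
have : K h <= K 0 by apply: hmax; rewrite gtr0_norm.
rewrite -subr_le0 E pmulr_lle0// => K1u.
have := hr u; rewrite gtr0_norm// add0r K10 subr0 => /(_ (lt_trans uh hr')).
rewrite ler_norml (_ : u *: k2 = u * k2)// => /andP[h1 _].
have : 0 < u * k2 by rewrite mulr_gt0.
lra.
Qed.

(* [rho] is the length of the projection of [D] on a fixed unit vector: by AM-GM the
   nonsmooth [enorm D] is dominated by a smooth quantity which agrees with it to third
   order when [D] only rotates at second order. *)
Lemma enorm_le_proj (R : realType) m (D : 'rV[R]_m) (rho : R) : 0 < rho ->
  2 * enorm D * rho <= dot D D + rho ^+ 2.
Proof. by move=> r0; rewrite -enorm_sqr; have := sqr_ge0 (enorm D - rho); rewrite sqrrB; lra. Qed.

(** With [V] and [c] frozen at the contact, |x - c|^2 - |z - c|^2 equals |x - y|^2 - |z - y|^2 - 2 C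
    <V, x - z>, so it vanishes at 0. The first-order condition holds for any pair of curves. The
    second-order one needs velocities that differ by a multiple of [V], because the distance picks
    up a positive term from any rotation of x - z, and velocities of equal length, so that their
    squares cancel. *)
Lemma contact_space (R : realType) m (x z x1 z1 : R -> 'rV[R]_m) (x2 z2 y V : 'rV[R]_m)
    (C d0 d : R) (c := y + C *: V) :
  0 < d0 -> 0 < C -> 0 < d -> dot V V = 1 -> x 0 - z 0 = d *: V ->
  (forall t, `|t| < d0 -> is_derive t (1 : R) x (x1 t)) ->
  (forall t, `|t| < d0 -> is_derive t (1 : R) z (z1 t)) ->
  is_derive (0 : R) (1 : R) x1 x2 -> is_derive (0 : R) (1 : R) z1 z2 ->
  (forall t, `|t| < d0 -> dot (x t - y) (x t - y) - dot (z t - y) (z t - y)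
     <= 2 * C * enorm (x t - z t)) ->
  dot (x 0 - y) (x 0 - y) - dot (z 0 - y) (z 0 - y) = 2 * C * enorm (x 0 - z 0) ->
  dot (x 0 - c) (x1 0) = dot (z 0 - c) (z1 0) /\
  (forall k : R, x1 0 - z1 0 = k *: V -> dot (x1 0) (x1 0) = dot (z1 0) (z1 0) ->
    dot (x 0 - c) x2 <= dot (z 0 - c) z2).
Proof.
move=> d00 C0 dpos VV D0 hx hz hx2 hz2 hle heq.
have dE : enorm (x 0 - z 0) = d by rewrite D0 enormZ gtr0_norm// /enorm VV sqrtr1 mulr1.
rewrite dE in heq.
pose A t := dot (x t - c) (x t - c) - dot (z t - c) (z t - c).
pose A1 t := 2 * dot (x t - c) (x1 t) - 2 * dot (z t - c) (z1 t).
pose rho t := dot V (x t - z t).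
pose rho1 t := dot V (x1 t - z1 t).
pose N t := dot (x t - z t) (x t - z t).
pose N1 t := 2 * dot (x t - z t) (x1 t - z1 t).
have hA t : `|t| < d0 -> is_derive t (1 : R) A (A1 t).
  move=> td; have hxc := is_derive_sub_cst c (hx t td); have hzc := is_derive_sub_cst c (hz t td).
  apply: (is_derive_eq (is_derive_sub (is_derive_dot hxc hxc) (is_derive_dot hzc hzc))).
  by rewrite /A1 (dotC (x1 t)) (dotC (z1 t)); ring.
have hD t : `|t| < d0 -> is_derive t (1 : R) (fun s => x s - z s) (x1 t - z1 t).
  by move=> td; exact: is_derive_sub (hx t td) (hz t td).
have hrho t : `|t| < d0 -> is_derive t (1 : R) rho (rho1 t).
  move=> td; have := is_derive_dot (is_derive_cst V t (1 : R)) (hD t td).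
  by rewrite dot0l add0r.
have hN t : `|t| < d0 -> is_derive t (1 : R) N (N1 t).
  move=> td; apply: (is_derive_eq (is_derive_dot (hD t td) (hD t td))).
  by rewrite /N1 (dotC (x1 t - z1 t)); ring.
have z0d : `|0 : R| < d0 by rewrite normr0.
have hA2 : is_derive (0 : R) (1 : R) A1
   (2 * (dot (x1 0) (x1 0) + dot (x 0 - c) x2) - 2 * (dot (z1 0) (z1 0) + dot (z 0 - c) z2)).
  have hxc := is_derive_sub_cst c (hx 0 z0d); have hzc := is_derive_sub_cst c (hz 0 z0d).
  have h1 := is_derive_mul (is_derive_cst (2 : R) (0 : R) (1 : R)) (is_derive_dot hxc hx2).
  have h2 := is_derive_mul (is_derive_cst (2 : R) (0 : R) (1 : R)) (is_derive_dot hzc hz2).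
  by apply: (is_derive_eq (is_derive_sub h1 h2)); rewrite !mul0r !add0r.
have hD2 := is_derive_sub hx2 hz2.
have hrho2 : is_derive (0 : R) (1 : R) rho1 (dot V (x2 - z2)).
  have := is_derive_dot (is_derive_cst V (0 : R) (1 : R)) hD2.
  by rewrite dot0l add0r.
have hN2 : is_derive (0 : R) (1 : R) N1
   (2 * (dot (x1 0 - z1 0) (x1 0 - z1 0) + dot (x 0 - z 0) (x2 - z2))).
  have h1 := is_derive_mul (is_derive_cst (2 : R) (0 : R) (1 : R)) (is_derive_dot (hD 0 z0d) hD2).
  by apply: (is_derive_eq h1); rewrite !mul0r !add0r.
(* Multiplying the two-point inequality by [rho] and applying [enorm_le_proj] gives [K <= 0] near 0,
   with equality at 0. No derivative of the norm has to be taken. *)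
pose K t := A t * rho t - C * (N t - rho t * rho t).
pose K1 t := (A1 t * rho t + A t * rho1 t) - C * (N1 t - (rho1 t * rho t + rho t * rho1 t)).
have hK t : `|t| < d0 -> is_derive t (1 : R) K (K1 t).
  move=> td; have h1 := is_derive_mul (hA t td) (hrho t td).
  have h2 := is_derive_sub (hN t td) (is_derive_mul (hrho t td) (hrho t td)).
  have h3 := is_derive_mul (is_derive_cst (C : R) t (1 : R)) h2.
  by apply: (is_derive_eq (is_derive_sub h1 h3)); rewrite /K1 mul0r add0r.
have rho0 : rho 0 = d by rewrite /rho D0 dotZr VV mulr1.
have N0 : N 0 = d * d by rewrite /N D0 dotZr dotZl VV mulr1.
have AE t : A t = dot (x t - y) (x t - y) - dot (z t - y) (z t - y) - 2 * C * rho t.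
  rewrite /A /c /rho !opprD !addrA.
  set X := x t - y; set Z := z t - y.
  have -> : x t - z t = X - Z by rewrite /X /Z opprB addrA subrK.
  move: X Z => X Z.
  by rewrite !dotE VV (dotC V X) (dotC V Z); ring.
have A0 : A 0 = 0 by rewrite AE rho0 heq; ring.
have [r r0 hr] : exists2 r : R, 0 < r & forall t, `|t| < r -> 0 < rho t.
  have e0 : 0 < d / 2 by rewrite divr_gt0.
  have hc : {for 0, continuous rho}.
    by apply: differentiable_continuous; apply/derivable1_diffP; have [] := hrho 0 z0d.
  have /cvgrPdist_lt/(_ _ e0)/nbhs_ballP[r r0 hr] := hc.
  exists r => // t tr; have := hr t; rewrite -ball_normE /= sub0r normrN rho0 => /(_ tr).
  rewrite ltr_norml => /andP[_]; lra.
have K0 : K 0 = 0 by rewrite /K A0 N0 rho0; ring.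
pose d1 := Order.min d0 r.
have d10 : 0 < d1 by rewrite lt_min d00.
have hKd t : `|t| < d1 -> is_derive t (1 : R) K (K1 t).
  by rewrite lt_min => /andP[td _]; exact: hK.
have hmax t : `|t| < d1 -> K t <= K 0.
  rewrite lt_min K0 => /andP[td tr]; have rt := hr t tr.
  have h1 := hle t td; have h2 := enorm_le_proj (x t - z t) rt.
  rewrite /K AE.
  set P := dot (x t - y) _ - dot _ _ in h1 *; set E := enorm _ in h1 h2.
  have h3 : P * rho t <= 2 * C * E * rho t by rewrite ler_pM2r.
  have h4 : C * (2 * E * rho t) <= C * (N t + rho t ^+ 2) by rewrite ler_pM2l.
  have : rho t ^+ 2 = rho t * rho t by rewrite expr2.
  nra.
pose T := 2 * (dot (x1 0) (x1 0) + dot (x 0 - c) x2) - 2 * (dot (z1 0) (z1 0) + dot (z 0 - c) z2).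
have hK2 : is_derive (0 : R) (1 : R) K1
   (T * d + A1 0 * rho1 0 + A1 0 * rho1 0
    - C * (2 * (dot (x1 0 - z1 0) (x1 0 - z1 0) + d * dot V (x2 - z2))
       - 2 * (rho1 0 * rho1 0 + d * dot V (x2 - z2)))).
  have h1 := is_derive_mul hA2 (hrho 0 z0d).
  have h2 := is_derive_mul (hA 0 z0d) hrho2.
  have h3 := is_derive_mul hrho2 (hrho 0 z0d).
  have h4 := is_derive_mul (hrho 0 z0d) hrho2.
  have h5 := is_derive_sub hN2 (is_deriveD h3 h4).
  have h6 := is_derive_mul (is_derive_cst (C : R) (0 : R) (1 : R)) h5.
  apply: (is_derive_eq (is_derive_sub (is_deriveD h1 h2) h6)).
  by rewrite A0 rho0 D0 (dotZl d V (x2 - z2)) /T !mul0r add0r addr0 (_ : cst C 0 = C)//; ring.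
have [K10 K2] := second_order_max d10 hKd hK2 hmax.
have A10 : A1 0 = 0.
  move: K10; rewrite /K1 A0 rho0 /N1 D0 dotZl -/(rho1 0) mul0r addr0.
  have -> : 2 * (d * rho1 0) - (rho1 0 * d + d * rho1 0) = 0 by ring.
  by rewrite mulr0 subr0 => /eqP; rewrite mulf_eq0 (gt_eqF dpos) orbF => /eqP.
split; first by move: A10; rewrite /A1; lra.
(* For velocities differing by a multiple of [V], the term |x1 - z1|^2 - [rho1]^2 in the second
   derivative of [K] vanishes, and only that of [A] remains. *)
move=> k xzk nxz; rewrite A10 /rho1 xzk !dotE VV /T nxz in K2.
move: (dot (x 0 - c) x2) (dot (z 0 - c) z2) K2 => a b K2.
have : 2 * (a - b) * d <= 0 by move: K2; lra.
by rewrite (pmulr_lle0 _ dpos); lra.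
Qed.

(** The one-sided counterpart of [contact_space]: only times before [t0] are compared, and the
    growth of [C] yields the strictly positive term [C1 * d] when [C1] is positive. *)
Lemma contact_time (R : realType) m (x z : R -> 'rV[R]_m) (x1 z1 y V : 'rV[R]_m)
    (C : R -> R) (C1 t0 d0 d : R) (c := y + C t0 *: V) :
  0 < d0 -> 0 < d -> dot V V = 1 -> x t0 - z t0 = d *: V ->
  is_derive t0 (1 : R) x x1 -> is_derive t0 (1 : R) z z1 ->
  is_derive t0 (1 : R) C C1 -> (forall h, 0 < h < d0 -> 0 <= C (t0 - h)) ->
  (forall h, 0 < h < d0 -> dot (x (t0 - h) - y) (x (t0 - h) - y)
     - dot (z (t0 - h) - y) (z (t0 - h) - y)
     <= 2 * C (t0 - h) * enorm (x (t0 - h) - z (t0 - h))) ->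
  dot (x t0 - y) (x t0 - y) - dot (z t0 - y) (z t0 - y) =
    2 * C t0 * enorm (x t0 - z t0) ->
  C1 * d <= dot (x t0 - c) x1 - dot (z t0 - c) z1.
Proof.
move=> d00 dpos VV D0 hx hz hC Cge0 hle heq.
have dE : enorm (x t0 - z t0) = d by rewrite D0 enormZ gtr0_norm// /enorm VV sqrtr1 mulr1.
rewrite dE in heq.
pose A t := dot (x t - c) (x t - c) - dot (z t - c) (z t - c).
pose A1 := 2 * dot (x t0 - c) x1 - 2 * dot (z t0 - c) z1.
pose rho t := dot V (x t - z t).
pose rho1 := dot V (x1 - z1).
pose N t := dot (x t - z t) (x t - z t).
have hA : is_derive t0 (1 : R) A A1.
  have hxc := is_derive_sub_cst c hx; have hzc := is_derive_sub_cst c hz.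
  apply: (is_derive_eq (is_derive_sub (is_derive_dot hxc hxc) (is_derive_dot hzc hzc))).
  by rewrite /A1 (dotC x1) (dotC z1); ring.
have hD : is_derive t0 (1 : R) (fun s => x s - z s) (x1 - z1) by exact: is_derive_sub hx hz.
have hrho : is_derive t0 (1 : R) rho rho1.
  by have := is_derive_dot (is_derive_cst V t0 (1 : R)) hD; rewrite dot0l add0r.
have hN : is_derive t0 (1 : R) N (2 * d * rho1).
  apply: (is_derive_eq (is_derive_dot hD hD)).
  by rewrite D0 dotZl dotZr /rho1 (dotC (x1 - z1)); ring.
have rho0 : rho t0 = d by rewrite /rho D0 dotZr VV mulr1.
have N0 : N t0 = d * d by rewrite /N D0 dotZr dotZl VV mulr1.
have AE t : A t = dot (x t - y) (x t - y) - dot (z t - y) (z t - y) - 2 * C t0 * rho t.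
  rewrite /A /c /rho !opprD !addrA.
  set X := x t - y; set Z := z t - y.
  have -> : x t - z t = X - Z by rewrite /X /Z opprB addrA subrK.
  move: X Z => X Z.
  by rewrite !dotE VV (dotC V X) (dotC V Z); ring.
have A0 : A t0 = 0 by rewrite AE rho0 heq; ring.
have [r r0 hr] : exists2 r : R, 0 < r & forall h, `|h| < r -> 0 < rho (t0 - h).
  have e0 : 0 < d / 2 by rewrite divr_gt0.
  have hc : {for t0, continuous rho}.
    by apply: differentiable_continuous; apply/derivable1_diffP; have [] := hrho.
  have /cvgrPdist_lt/(_ _ e0)/nbhs_ballP[r r0 hr] := hc.
  exists r => // h hh; have := hr (t0 - h); rewrite -ball_normE /= opprB addrC subrK rho0 => /(_ hh).
  rewrite ltr_norml => /andP[_]; lra.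
pose K t := A t * rho t - C t * (N t + rho t * rho t) + 2 * C t0 * (rho t * rho t).
have hK : is_derive t0 (1 : R) K (A1 * d - C1 * (2 * (d * d))).
  have h2 := is_derive_mul hrho hrho.
  have h3 := is_derive_mul hC (is_deriveD hN h2).
  have h4 := is_derive_mul (is_derive_cst (2 * C t0 : R) t0 (1 : R)) h2.
  apply: (is_derive_eq (is_deriveD (is_derive_sub (is_derive_mul hA hrho) h3) h4)).
  rewrite A0 !mul0r add0r addr0 rho0 (_ : (N + _) t0 = N t0 + rho t0 * rho t0)//.
  by rewrite N0 rho0 (_ : cst _ _ = 2 * C t0)//; ring.
have dr : 0 < Order.min d0 r by rewrite lt_min d00.
have /(left_max_derive_ge0 hK dr) : forall h, 0 < h < Order.min d0 r -> K (t0 - h) <= K t0.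
  move=> h /andP[h0]; rewrite lt_min => /andP[hd hr'].
  have h0d : 0 < h < d0 by rewrite h0.
  have rt : 0 < rho (t0 - h) by apply: hr; rewrite gtr0_norm.
  have -> : K t0 = 0 by rewrite /K A0 rho0 N0; ring.
  have h1 := hle h h0d; have h2 := enorm_le_proj (x (t0 - h) - z (t0 - h)) rt.
  have h3 := Cge0 h h0d; rewrite /K AE; move: h1 h2 h3 rt.
  rewrite -/(N (t0 - h)); set P := dot (x (t0 - h) - y) _ - dot _ _; set E := enorm _.
  move: (rho (t0 - h)) (C (t0 - h)) (N (t0 - h)) => q k NN h1 h2 h3 rt.
  have h4 : P * q <= 2 * k * E * q by rewrite ler_pM2r.
  have h5 : k * (2 * E * q) <= k * (NN + q ^+ 2) by rewrite ler_wpM2l.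
  have : q ^+ 2 = q * q by rewrite expr2.
  nra.
have -> : A1 * d - C1 * (2 * (d * d)) = (A1 - 2 * (C1 * d)) * d by ring.
rewrite (pmulr_lge0 _ dpos) /A1; lra.
Qed.

(* Both mixed derivatives are limits of the same second difference quotient. *)
Lemma second_difference (R : realType) (V : normedModType R) (U : set V) (f : V -> R) x v w (e : R) :
  C1_on U f -> C1_on U ('D_v f) -> U x -> 0 < e ->
  exists2 r : R, 0 < r & forall h, 0 < h < r ->
    `|f (x + h *: v + h *: w) - f (x + h *: v) - f (x + h *: w) + f x
      - h ^+ 2 * 'D_w ('D_v f) x| <= e * h ^+ 2.
Proof.
move=> [Uo df] [_ d2f] Ux e0.
have [r r0 hr] : exists2 r : R, 0 < r & forall y, `|y - x| < r ->
    U y /\ `|'D_w ('D_v f) x - 'D_w ('D_v f) y| <= e.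
  have U0 : \forall y \near x, U y by exact: open_nbhs_nbhs.
  have [_ cw] := d2f x Ux w.
  have /nbhs_ballP[r r0 hr] : \forall y \near x, U y /\ `|'D_w ('D_v f) x - 'D_w ('D_v f) y| <= e.
    near=> y; split; first by near: y.
    by near: y; move/cvgrPdist_le : cw; exact.
  by exists r => // y yx; apply: hr; rewrite -ball_normE /= distrC.
have c0 : 0 < `|v| + `|w| + 1 by rewrite ltr_wpDl// addr_ge0.
exists (r / (`|v| + `|w| + 1)); first by rewrite divr_gt0.
move=> h /andP[h0]; rewrite ltr_pdivlMr// => hr'.
have inb (s t : R) : 0 <= s <= h -> 0 <= t <= h -> `|x + s *: v + t *: w - x| < r.
  move=> /andP[s0 sh] /andP[t0 th]; apply: le_lt_trans hr'.
  rewrite addrC -addrA addKr; apply: le_trans (ler_normD _ _) _.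
  rewrite !normrZ !ger0_norm// !mulrDr mulr1.
  have : s * `|v| <= h * `|v| by rewrite ler_wpM2r.
  have : t * `|w| <= h * `|w| by rewrite ler_wpM2r.
  lra.
(* The second difference is [g h - g 0]: the mean value theorem is applied to [g] in direction [v],
   then to ['D_v f] in direction [w]. *)
pose g (s : R) := f (x + h *: w + s *: v) - f (x + s *: v).
have hg (s : R) : 0 <= s <= h -> is_derive s 1 g ('D_v f (x + h *: w + s *: v) - 'D_v f (x + s *: v)).
  move=> sh; apply: is_derive_sub; apply: is_derive_line.
    have hh : 0 <= h <= h by rewrite (ltW h0)/=.
    have [Uy _] := hr _ (inb s h sh hh).
    by rewrite addrAC; have [] := df _ Uy v.
  have hh : (0 : R) <= 0 <= h by rewrite lexx (ltW h0).
  have := inb s 0 sh hh; rewrite scale0r addr0 => /hr[Uy _].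
  by have [] := df _ Uy v.
have hgo s : s \in `]0, h[ -> is_derive s 1 g ('D_v f (x + h *: w + s *: v) - 'D_v f (x + s *: v)).
  by rewrite in_itv /= => /andP[s0 sh]; apply: hg; rewrite !ltW.
have gc : {within `[0, h], continuous g}.
  apply: derivable_within_continuous => s; rewrite in_itv /= => sh.
  by have [] := hg s sh.
have [s] := MVT h0 hgo gc; rewrite in_itv /= => /andP[s0 sh] E.
have sh' : 0 <= s <= h by rewrite !ltW.
have [|t t01 E2] := @MVT_line _ _ ('D_v f) (x + s *: v) (h *: w).
  move=> t /andP[t0 t1]; rewrite scalerA.
  have th : 0 <= t * h <= h by rewrite mulr_ge0 ?(ltW h0)//= ler_piMl// ltW.
  have [Uy _] := hr _ (inb s (t * h) sh' th).
  by have [] := d2f _ Uy (h *: w).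
move: t01 => /andP[t0 t1]; rewrite scalerA in E2.
have th : 0 <= t * h <= h by rewrite mulr_ge0 ?(ltW h0)//= ler_piMl// ltW.
have [Uy Dy] := hr _ (inb s (t * h) sh' th).
rewrite deriveZdir in E2; last by have [] := d2f _ Uy w.
have -> : f (x + h *: v + h *: w) - f (x + h *: v) - f (x + h *: w) + f x = g h - g 0.
  by rewrite /g !scale0r !addr0 (addrAC x); ring.
rewrite E subr0 (addrAC x (h *: w)) E2.
set p := 'D_w ('D_v f) x in Dy *; set q := 'D_w _ (_ + _) in Dy *.
have -> : h *: q * h - h ^+ 2 * p = - (h ^+ 2 * (p - q)).
  by rewrite (_ : h *: q = h * q)//; ring.
by rewrite normrN normrM ger0_norm ?sqr_ge0// mulrC ler_wpM2r ?sqr_ge0.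
Unshelve. all: by end_near. Qed.

(** Two errors of a quarter of the gap add up to half of it, which is less than the gap itself. *)
Lemma second_difference_unique (R : realType) (S P Q X p q k : R) :
  0 < `|p - q| -> 0 < k -> `|S - P - Q + X - k * p| <= `|p - q| / 4 * k ->
  `|S - Q - P + X - k * q| <= `|p - q| / 4 * k -> False.
Proof.
move=> D0 k0 h1 h2.
have : `|k * (p - q)| <= `|p - q| / 2 * k.
  have -> : k * (p - q) = (S - Q - P + X - k * q) - (S - P - Q + X - k * p) by ring.
  apply: le_trans (ler_normB _ _) _; move: h1 h2; lra.
rewrite normrM gtr0_norm// mulrC (ler_pM2r k0); lra.
Qed.

Lemma derive_comm (R : realType) (V : normedModType R) (U : set V) (f : V -> R) x v w :
  C1_on U f -> C1_on U ('D_v f) -> C1_on U ('D_w f) -> U x ->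
  'D_w ('D_v f) x = 'D_v ('D_w f) x.
Proof.
move=> fC fv fw Ux; apply/eqP; rewrite -subr_eq0 -normr_le0 leNgt; apply/negP.
move=> D0.
have e0 : 0 < `|'D_w ('D_v f) x - 'D_v ('D_w f) x| / 4 by rewrite divr_gt0.
have [r r0 hr] := second_difference w fC fv Ux e0.
have [r' r'0 hr'] := second_difference v fC fw Ux e0.
have m0 : 0 < Order.min r r' by rewrite lt_min r0.
have h0 : 0 < Order.min r r' / 2 by rewrite divr_gt0.
have : Order.min r r' / 2 < Order.min r r' by lra.
move: h0; move: (_ / 2) => h h0; rewrite lt_min => /andP[hr1 hr2].
have h1 : 0 < h < r by rewrite h0.
have h2 : 0 < h < r' by rewrite h0.
have := hr' h h2; rewrite (addrAC x) => h3.
exact: second_difference_unique D0 (exprn_gt0 2 h0) (hr h h1) h3.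
Qed.

Lemma smooth_on_near_line (R : realType) (V : normedModType R) (U : set V) (u xi : V) :
  open U -> U u -> exists2 d : R, 0 < d & forall t, `|t| < d -> U (u + t *: xi).
Proof.
move=> Uo Uu; have /nbhs_ballP[r r0 hr] : nbhs u U by exact: open_nbhs_nbhs.
have c0 : 0 < `|xi| + 1 by rewrite ltr_wpDl.
exists (r / (`|xi| + 1)); first by rewrite divr_gt0.
move=> t; rewrite ltr_pdivlMr// => tr; apply: hr.
rewrite -ball_normE /= opprD addrA subrr add0r normrN normrZ.
by apply: le_lt_trans tr; rewrite ler_wpM2l// lerDl.
Qed.

Lemma near_eq_C1_on (R : realType) (V W : normedModType R) (U : set V) (f g : V -> W) :
  (forall x, U x -> f x = g x) -> C1_on U f -> C1_on U g.
Proof.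
move=> fg [Uo fC]; split => // x Ux v.
have nE y : U y -> \forall z \near y, f z = g z.
  move=> Uy; have : \forall z \near y, U z by exact: open_nbhs_nbhs.
  by apply: filterS => z; exact: fg.
have [df cf] := fC x Ux v; split; first exact: near_eq_derivable (nE x Ux) df.
have DE y : U y -> 'D_v f y = 'D_v g y by move=> Uy; exact: near_eq_derive (nE y Uy).
have {}cf : 'D_v f @ x --> 'D_v g x by rewrite -(DE x Ux).
apply: cvg_trans cf; apply: near_eq_cvg.
have : \forall z \near x, U z by exact: open_nbhs_nbhs.
by apply: filterS => y Uy; rewrite DE.
Qed.

Lemma derive_comm_row (R : realType) (V : normedModType R) m (U : set V) (X : V -> 'rV[R]_m) u v w :
  open U -> smooth_on U X -> U u -> 'D_w ('D_v X) u = 'D_v ('D_w X) u.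
Proof.
move=> Uo Xs Uu.
have XC := smooth_on_C1 Uo Xs.
have DC v' := smooth_on_C1 Uo (smooth_on_derive v' Xs).
apply/rowP => k; have [Xk XkE] := C1_on_coord 0 k XC.
have DE v' y : U y -> ('D_v' X y) 0 k = 'D_v' (fun x => X x 0 k) y by move=> Uy; rewrite XkE.
have CC v' : C1_on U ('D_v' (fun x => X x 0 k)).
  exact: near_eq_C1_on (DE v') (C1_on_coord 0 k (DC v')).1.
have cE v' w' : ('D_w' ('D_v' X) u) 0 k = 'D_w' ('D_v' (fun x => X x 0 k)) u.
  rewrite -(C1_on_coord 0 k (DC v')).2//; apply: near_eq_derive.
  have : \forall y \near u, U y by exact: open_nbhs_nbhs.
  by apply: filterS => y Uy; rewrite DE.
have E := derive_comm Xk (CC v) (CC w) Uu.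
by apply: (etrans (cE v w)); apply: (etrans E); apply: esym; exact: cE.
Qed.

Lemma second_form_sym (R : realType) n m (U : set 'rV[R]_n) (X : 'rV[R]_n -> 'rV[R]_m) u nu :
  open U -> smooth_on U X -> U u -> (second_form X u nu)^T = second_form X u nu.
Proof.
move=> Uo Xs Uu; apply/matrixP => i j; rewrite mxE [LHS]mxE [RHS]mxE.
by rewrite (derive_comm_row (delta_mx 0 i) (delta_mx 0 j) Uo Xs Uu).
Qed.

(** The second derivative along a coordinate line is bilinear in the direction; the sign is the one
    built into [second_form]. *)
Lemma second_form_quad (R : realType) n m (U : set 'rV[R]_n) (X : 'rV[R]_n -> 'rV[R]_m) u nu xi :
  open U -> smooth_on U X -> U u ->
  dot ('D_xi ('D_xi X) u) nu = - (xi *m second_form X u nu *m xi^T) 0 0.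
Proof.
move=> Uo Xs Uu.
have XC := smooth_on_C1 Uo Xs.
have DC v := smooth_on_C1 Uo (smooth_on_derive v Xs).
have -> : 'D_xi ('D_xi X) u = \sum_j xi 0 j *: \sum_i xi 0 i *: 'D_(delta_mx 0 i) ('D_(delta_mx 0 j) X) u.
  rewrite (@near_eq_derive _ _ _ _ (fun y => \sum_j xi 0 j *: 'D_(delta_mx 0 j) X y)); last first.
    have : \forall y \near u, U y by exact: open_nbhs_nbhs.
    apply: filterS => y Uy.
    by rewrite [in LHS](row_sum_delta xi) (C1_rowP XC Uy).2.
  have dj j : derivable (xi 0 j \*: 'D_(delta_mx 0 j) X) u xi.
    by apply: derivableZ; have [_ /(_ u Uu xi)[]] := DC (delta_mx 0 j).
  have -> : (fun y => \sum_j xi 0 j *: 'D_(delta_mx 0 j) X y) = \sum_j (xi 0 j \*: 'D_(delta_mx 0 j) X).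
    by apply: funext => y; rewrite fct_sumE.
  rewrite derive_sum//; apply: eq_bigr => j _.
  have [_ /(_ u Uu xi)[dd _]] := DC (delta_mx 0 j).
  rewrite deriveZ//; congr (_ *: _).
  by rewrite [in LHS](row_sum_delta xi) (C1_rowP (DC _) Uu).2.
have dot_sum k (f : 'I_k -> 'rV[R]_m) : dot (\sum_j f j) nu = \sum_j dot (f j) nu.
  by rewrite (big_morph (fun v => dot v nu) (fun a b => dotDl a b nu) (dot0l nu)).
rewrite mxE -sumrN dot_sum; apply: eq_bigr => j _.
rewrite dotZl dot_sum mxE mulr_suml mulr_sumr -sumrN; apply: eq_bigr => i _.
rewrite dotZl [second_form _ _ _ i j]mxE [xi^T j 0]mxE.
by move: (dot _ _) => q; ring.
Qed.

(** The orthogonal complement of n independent rows in dimension n + 1 is a line. *)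
Lemma normal_unique (R : realType) n (J : 'M[R]_(n, n.+1)) (nu a : 'rV[R]_n.+1) :
  row_free J -> J *m nu^T = 0 -> enorm nu = 1 -> J *m a^T = 0 ->
  a = dot a nu *: nu.
Proof.
move=> Jf Jnu nu1 Ja.
have nu_in : (nu <= kermx J^T)%MS.
  by apply/sub_kermxP; apply: trmx_inj; rewrite trmx_mul !trmxK trmx0.
have a_in : (a <= kermx J^T)%MS.
  by apply/sub_kermxP; apply: trmx_inj; rewrite trmx_mul !trmxK trmx0.
have rk : \rank (kermx J^T) = 1%N.
  by rewrite mxrank_ker mxrank_tr (eqP Jf) subSn// subnn.
have nu0 : nu != 0 by rewrite -enorm_gt0 nu1.
have knu : (kermx J^T <= nu)%MS.
  by rewrite -(geq_leqif (mxrank_leqif_sup nu_in)) rk rank_rV nu0.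
have /sub_rVP[k ->] := submx_trans a_in knu.
by rewrite dotZl -enorm_sqr nu1 expr1n mulr1.
Qed.

Lemma gram_posdef (R : realType) n m (J : 'M[R]_(n, m)) :
  row_free J -> forall v : 'rV_n, v != 0 -> 0 < (v *m (J *m J^T) *m v^T) 0 0.
Proof.
move=> Jf v v0; rewrite !mulmxA -mulmxA -trmx_mul -dot_mx dot_gt0.
by rewrite mulmx_free_eq0.
Qed.

(** * Reflections and the comparison of shape operators at a contact *)

Definition reflect_mx (R : realType) m (V : 'rV[R]_m) : 'M[R]_m := 1%:M - 2 *: (V^T *m V).

Lemma mul_reflect_mx (R : realType) m (V w : 'rV[R]_m) :
  w *m reflect_mx V = w - (2 * dot w V) *: V.
Proof.
rewrite /reflect_mx mulmxBr mulmx1 -scalemxAr mulmxA; congr (_ - _).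
by rewrite [w *m V^T]mx11_scalar -dot_mx mul_scalar_mx scalerA.
Qed.

Lemma reflect_mx_tr (R : realType) m (V : 'rV[R]_m) : (reflect_mx V)^T = reflect_mx V.
Proof.
rewrite /reflect_mx; apply/matrixP => i j; rewrite !mxE (eq_sym j).
congr (_ - _ * _); apply: eq_bigr => k _; rewrite !mxE; ring.
Qed.

Lemma reflect_mx_invol (R : realType) m (V : 'rV[R]_m) : dot V V = 1 ->
  reflect_mx V *m reflect_mx V = 1%:M.
Proof.
move=> VV; apply/row_matrixP => i; rewrite !rowE mulmx1 mulmxA.
by rewrite !mul_reflect_mx dotDl dotNl dotZl VV; apply/rowP => j; rewrite !mxE; ring.
Qed.

Section contact.
Context (R : realType) (n : nat) (G : set 'rV[R]_n) (F : 'rV[R]_n -> R).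
Context (G_sym : symmetric_set G) (F_sym : symmetric_fun_on G F).
Context (F_mono : forall x z, G x -> G z -> (forall i, x 0 i <= z 0 i) -> F x <= F z).

(* Shape operators of two surfaces whose tangent planes are exchanged by [L] are compared
   in the common frame given by [J1 *m L = B *m J2]. *)
Lemma shape_compare m (J1 J2 : 'M[R]_(n, m)) (L : 'M[R]_m) (A1 A2 B : 'M[R]_n)
    (lam1 lam2 : 'rV[R]_n) :
  row_free J1 -> row_free J2 -> A1^T = A1 -> A2^T = A2 ->
  L *m L^T = 1%:M -> J1 *m L = B *m J2 ->
  char_poly (A1 *m invmx (J1 *m J1^T)) = \prod_(i < n) ('X - (lam1 0 i)%:P) ->
  char_poly (A2 *m invmx (J2 *m J2^T)) = \prod_(i < n) ('X - (lam2 0 i)%:P) ->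
  G lam1 -> G lam2 ->
  ((forall xi : 'rV_n, (xi *m B *m A2 *m (xi *m B)^T) 0 0 <= (xi *m A1 *m xi^T) 0 0) ->
    F lam2 <= F lam1) /\
  ((forall xi : 'rV_n, (xi *m A1 *m xi^T) 0 0 <= (xi *m B *m A2 *m (xi *m B)^T) 0 0) ->
    F lam1 <= F lam2).
Proof.
move=> J1f J2f A1t A2t LL JB ch1 ch2 G1 G2.
have I1p := gram_posdef J1f; have I2p := gram_posdef J2f.
have I1t : (J1 *m J1^T)^T = J1 *m J1^T by rewrite trmx_mul trmxK.
have I1E : J1 *m J1^T = B *m (J2 *m J2^T) *m B^T.
  have -> : J1 *m J1^T = (J1 *m L) *m (J1 *m L)^T.
    by rewrite trmx_mul mulmxA -(mulmxA _ L) LL mulmx1.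
  by rewrite JB trmx_mul !mulmxA.
have I1u := posdef_unitmx I1p; have I2u := posdef_unitmx I2p.
move: (J1 *m J1^T) (J2 *m J2^T) ch1 ch2 I1p I2p I1t I1E I1u I2u => I1 I2 ch1 ch2 I1p I2p I1t I1E I1u I2u.
have Bu : B \in unitmx by move: I1u; rewrite I1E !unitmx_mul => /andP[/andP[]].
pose A2' := B *m A2 *m B^T.
have A2t' : A2'^T = A2' by rewrite /A2' !trmx_mul trmxK A2t mulmxA.
have ch2' : char_poly (A2' *m invmx I1) = \prod_(i < n) ('X - (lam2 0 i)%:P).
  rewrite -ch2; apply: etrans (char_poly_conj (A2 *m invmx I2) Bu); congr char_poly.
  apply: (can_inj (mulmxK I1u)); rewrite (mulmxKV I1u) I1E !mulmxA.
  by rewrite (mulmxKV Bu) (mulmxKV I2u).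
have qE (xi : 'rV_n) : xi *m B *m A2 *m (xi *m B)^T = xi *m A2' *m xi^T.
  by rewrite /A2' trmx_mul !mulmxA.
split=> h.
  apply: (symmetric_fun_pencil_le G_sym F_sym F_mono A1t A2t' I1t I1p ch1 ch2') => // xi.
  by rewrite -qE.
apply: (symmetric_fun_pencil_le G_sym F_sym F_mono A2t' A1t I1t I1p ch2' ch1) => // xi.
by rewrite -qE.
Qed.

(** Here [a] and [b] are x - c and z - c, and [w1 xi], [w2 eta] are accelerations along coordinate
    lines. The first-order condition makes [a] and [b] normal. As |a| = |b|, the reflection carries
    [b] to [a] and hence one tangent plane to the other; this supplies the pairs of directions to
    which the second-order condition applies. *)
Lemma contact_algebra (Jx Jz : 'M[R]_(n, n.+1)) (A1 A2 : 'M[R]_n)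
    (nux nuz a b V : 'rV[R]_n.+1) (w1 w2 : 'rV[R]_n -> 'rV[R]_n.+1)
    (lamx lamz : 'rV[R]_n) (d : R) :
  row_free Jx -> row_free Jz -> A1^T = A1 -> A2^T = A2 ->
  enorm nux = 1 -> Jx *m nux^T = 0 -> enorm nuz = 1 -> Jz *m nuz^T = 0 ->
  char_poly (A1 *m invmx (Jx *m Jx^T)) = \prod_(i < n) ('X - (lamx 0 i)%:P) ->
  char_poly (A2 *m invmx (Jz *m Jz^T)) = \prod_(i < n) ('X - (lamz 0 i)%:P) ->
  G lamx -> G lamz ->
  0 < d -> dot V V = 1 -> a - b = d *: V -> dot a a = dot b b ->
  (forall xi eta, dot a (xi *m Jx) = dot b (eta *m Jz)) ->
  (forall xi eta k, xi *m Jx - eta *m Jz = k *: V ->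
    dot (xi *m Jx) (xi *m Jx) = dot (eta *m Jz) (eta *m Jz) ->
    dot a (w1 xi) <= dot b (w2 eta)) ->
  (forall xi, dot (w1 xi) nux = - (xi *m A1 *m xi^T) 0 0) ->
  (forall xi, dot (w2 xi) nuz = - (xi *m A2 *m xi^T) 0 0) ->
  exists k k' : R, [/\ a = k *: nux, b = k' *: nuz, k ^+ 2 = k' ^+ 2, k != 0
    & (0 < k -> k = k' -> F lamz <= F lamx) /\ (k < 0 -> k = k' -> F lamx <= F lamz)].
Proof.
move=> Jxf Jzf A1t A2t nux1 Jnux nuz1 Jnuz chx chz Gx Gz d0 VV abd aabb cur1 cur2 w1E w2E.
have orth (J : 'M[R]_(n, n.+1)) (q : 'rV[R]_n.+1) :
    (forall xi, dot q (xi *m J) = 0) -> J *m q^T = 0.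
  move=> h; apply/matrixP => i j; rewrite ord1 [RHS]mxE -(h (delta_mx 0 i)) dotC dot_mx.
  by rewrite -mulmxA -rowE [RHS]mxE.
(* The directions [xi] and [eta] are independent, so setting one of them to zero makes the other
   side vanish. *)
have Ja : Jx *m a^T = 0.
  by apply: orth => xi; rewrite (cur1 xi 0) mul0mx dotC dot0l.
have Jb : Jz *m b^T = 0.
  by apply: orth => eta; rewrite -(cur1 0 eta) mul0mx dotC dot0l.
have aE := normal_unique Jxf Jnux nux1 Ja; have bE := normal_unique Jzf Jnuz nuz1 Jb.
have unit_sq (q nu : 'rV[R]_n.+1) (k : R) : enorm nu = 1 -> q = k *: nu -> k ^+ 2 = dot q q.
  by move=> nu1 ->; rewrite dotZl dotZr -enorm_sqr nu1 expr1n mulr1 expr2.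
have aaE := unit_sq _ _ _ nux1 aE; have bbE := unit_sq _ _ _ nuz1 bE.
have k0 : dot a nux != 0.
  apply/eqP => k0; have a0 : dot a a = 0 by rewrite -aaE k0 expr0n.
  have /eqP : dot a a = 0 by []. rewrite dot_eq0 => /eqP a00.
  have /eqP : dot b b = 0 by rewrite -aabb. rewrite dot_eq0 => /eqP b00.
  have := VV; have : d *: V = 0 by rewrite -abd a00 b00 subr0.
  move=> /eqP; rewrite scaler_eq0 gt_eqF//= => /eqP ->; rewrite dot0l => /eqP.
  by rewrite eq_sym oner_eq0.
exists (dot a nux), (dot b nuz); split => //; first by rewrite aaE bbE.
have aV : a = b + d *: V by rewrite -abd addrC subrK.
have bV : 2 * dot b V = - d.
  have : dot a a = dot b b + d * (2 * dot b V + d).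
    by rewrite aV !dotE VV (dotC V b); ring.
  rewrite aabb => /eqP; rewrite -subr_eq0 opprD addrA subrr add0r oppr_eq0 mulf_eq0 gt_eqF//=.
  by move=> /eqP; lra.
have bL : b *m reflect_mx V = a by rewrite mul_reflect_mx bV scaleNr opprK -aV.
have b0 : b != 0.
  by apply: contraNneq k0 => b0; rewrite -bL b0 mul0mx dot0l.
(* The reflected tangent plane at x is orthogonal to [b], and the rows of [Jz] already span that
   complement, by rank. *)
have JL : (Jx *m reflect_mx V <= Jz)%MS.
  have Jzk : (Jz <= kermx b^T)%MS by apply/sub_kermxP.
  have rk : \rank (kermx b^T) = n by rewrite mxrank_ker mxrank_tr rank_rV b0 subn1.
  have kJz : (kermx b^T <= Jz)%MS.
    by rewrite -(geq_leqif (mxrank_leqif_sup Jzk)) rk (eqP Jzf).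
  apply: submx_trans kJz; apply/sub_kermxP.
  by rewrite -mulmxA -[reflect_mx V]reflect_mx_tr -trmx_mul bL.
have [B JB] := submxP JL.
have LL : reflect_mx V *m (reflect_mx V)^T = 1%:M by rewrite reflect_mx_tr reflect_mx_invol.
have [h1 h2] := shape_compare Jxf Jzf A1t A2t LL JB chx chz Gx Gz.
have key (xi : 'rV[R]_n) : dot a nux * - (xi *m A1 *m xi^T) 0 0 <=
    dot b nuz * - (xi *m B *m A2 *m (xi *m B)^T) 0 0.
  rewrite -w1E -w2E.
  have -> : dot a nux * dot (w1 xi) nux = dot a (w1 xi) by rewrite [in RHS]aE dotZl (dotC nux).
  have -> : dot b nuz * dot (w2 (xi *m B)) nuz = dot b (w2 (xi *m B)).
    by rewrite [in RHS]bE dotZl (dotC nuz).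
  have xB : xi *m B *m Jz = xi *m Jx *m reflect_mx V by rewrite -!mulmxA JB.
  (* A vector and its reflection differ by a multiple of [V] and have the same length, which is what
     [cur2] requires. *)
  apply: (cur2 _ _ (2 * dot (xi *m Jx) V)); rewrite xB.
    by rewrite mul_reflect_mx opprB addrC subrK.
  by rewrite [RHS]dot_mulmx -(mulmxA (xi *m Jx)) LL mulmx1.
move: (dot a nux) (dot b nuz) key => k k' key.
split=> k_sgn kk'; [apply: h1|apply: h2] => xi; have := key xi; rewrite -kk'.
  by rewrite (ler_pM2l k_sgn) lerN2.
by rewrite (ler_nM2l k_sgn) lerN2.
Qed.

(** [contact_space] is applied to every pair of coordinate lines through the two contact points; the
    rest is [contact_algebra]. *)
Lemma contact_geometry (X Z : 'rV[R]_n -> 'rV[R]_n.+1) U1 U2 u v nux nuz (y V : 'rV[R]_n.+1)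
    (lamx lamz : 'rV[R]_n) (C d : R) (c := y + C *: V) :
  open U1 -> smooth_on U1 X -> U1 u -> row_free ('J X u) ->
  open U2 -> smooth_on U2 Z -> U2 v -> row_free ('J Z v) ->
  enorm nux = 1 -> 'J X u *m nux^T = 0 -> enorm nuz = 1 -> 'J Z v *m nuz^T = 0 ->
  char_poly (shape_operator X u nux) = \prod_(i < n) ('X - (lamx 0 i)%:P) ->
  char_poly (shape_operator Z v nuz) = \prod_(i < n) ('X - (lamz 0 i)%:P) ->
  G lamx -> G lamz ->
  0 < C -> 0 < d -> dot V V = 1 -> X u - Z v = d *: V ->
  (forall u' v', U1 u' -> U2 v' ->
     dot (X u' - y) (X u' - y) - dot (Z v' - y) (Z v' - y) <= 2 * C * enorm (X u' - Z v')) ->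
  dot (X u - y) (X u - y) - dot (Z v - y) (Z v - y) = 2 * C * enorm (X u - Z v) ->
  exists k k' : R, [/\ X u - c = k *: nux, Z v - c = k' *: nuz, k ^+ 2 = k' ^+ 2, k != 0
    & (0 < k -> k = k' -> F lamz <= F lamx) /\ (k < 0 -> k = k' -> F lamx <= F lamz)].
Proof.
move=> U1o Xs Uu Jxf U2o Zs Uv Jzf nux1 Jnux nuz1 Jnuz chx chz Gx Gz C0 d0 VV D0 hle heq.
have XC := smooth_on_C1 U1o Xs; have ZC := smooth_on_C1 U2o Zs.
set a := X u - c; set b := Z v - c.
have curves xi eta :
    dot a (xi *m 'J X u) = dot b (eta *m 'J Z v) /\
    (forall k, xi *m 'J X u - eta *m 'J Z v = k *: V ->
      dot (xi *m 'J X u) (xi *m 'J X u) = dot (eta *m 'J Z v) (eta *m 'J Z v) ->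
      dot a ('D_xi ('D_xi X) u) <= dot b ('D_eta ('D_eta Z) v)).
  have [r r0 hr] := smooth_on_near_line xi U1o Uu.
  have [r' r'0 hr'] := smooth_on_near_line eta U2o Uv.
  have line W (Y : 'rV[R]_n -> 'rV[R]_n.+1) w ze t : C1_on W Y -> W (w + t *: ze) ->
      is_derive t (1 : R) (fun s => Y (w + s *: ze)) ('D_ze Y (w + t *: ze)).
    by move=> [_ YC] Ww; apply: is_derive_line; have [] := YC _ Ww ze.
  have line0 W (Y : 'rV[R]_n -> 'rV[R]_n.+1) w ze : open W -> smooth_on W Y -> W w ->
      is_derive (0 : R) (1 : R) (fun s => 'D_ze Y (w + s *: ze)) ('D_ze ('D_ze Y) w).
    move=> Wo Ys Ww; have := line W ('D_ze Y) w ze 0; rewrite scale0r addr0; apply => //.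
    exact: smooth_on_C1 Wo (smooth_on_derive ze Ys).
  have rr0 : 0 < Order.min r r' by rewrite lt_min r0.
  have E0 : (X (u + 0 *: xi) = X u) * (Z (v + 0 *: eta) = Z v) *
      ('D_xi X (u + 0 *: xi) = xi *m 'J X u) * ('D_eta Z (v + 0 *: eta) = eta *m 'J Z v).
    by rewrite !scale0r !addr0 (jacobian_C1 _ XC Uu) (jacobian_C1 _ ZC Uv).
  have D0' : X (u + 0 *: xi) - Z (v + 0 *: eta) = d *: V by rewrite !E0.
  have hx t : `|t| < Order.min r r' ->
      is_derive t (1 : R) (fun s => X (u + s *: xi)) ('D_xi X (u + t *: xi)).
    by rewrite lt_min => /andP[tr _]; apply: line XC _; exact: hr.
  have hz t : `|t| < Order.min r r' ->
      is_derive t (1 : R) (fun s => Z (v + s *: eta)) ('D_eta Z (v + t *: eta)).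
    by rewrite lt_min => /andP[_ tr]; apply: line ZC _; exact: hr'.
  have hxx := line0 U1 X u xi U1o Xs Uu; have hzz := line0 U2 Z v eta U2o Zs Uv.
  have hle' t : `|t| < Order.min r r' ->
      dot (X (u + t *: xi) - y) (X (u + t *: xi) - y) -
      dot (Z (v + t *: eta) - y) (Z (v + t *: eta) - y) <=
      2 * C * enorm (X (u + t *: xi) - Z (v + t *: eta)).
    by rewrite lt_min => /andP[tr tr']; apply: hle; [exact: hr|exact: hr'].
  have heq' : dot (X (u + 0 *: xi) - y) (X (u + 0 *: xi) - y) -
      dot (Z (v + 0 *: eta) - y) (Z (v + 0 *: eta) - y) =
      2 * C * enorm (X (u + 0 *: xi) - Z (v + 0 *: eta)) by rewrite !E0.
  have := contact_space rr0 C0 d0 VV D0' hx hz hxx hzz hle' heq'.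
  by rewrite !E0.
have abd : a - b = d *: V by rewrite -D0 /a /b opprB addrA subrK.
have aabb : dot a a = dot b b.
  have dE : enorm (X u - Z v) = d by rewrite D0 enormZ gtr0_norm// /enorm VV sqrtr1 mulr1.
  rewrite dE in heq; apply/eqP; rewrite -subr_eq0; apply/eqP.
  have -> : dot a a - dot b b = dot (X u - y) (X u - y) - dot (Z v - y) (Z v - y)
      - 2 * C * dot V (X u - Z v).
    have -> : X u - Z v = (X u - y) - (Z v - y) by rewrite opprB addrA subrK.
    have -> : a = X u - y - C *: V by rewrite /a /c opprD addrA.
    have -> : b = Z v - y - C *: V by rewrite /b /c opprD addrA.
    move: (X u - y) (Z v - y) => P Q.
    by rewrite !dotE VV (dotC V P) (dotC V Q); ring.
  by rewrite heq D0 dotZr VV; ring.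
have q1 xi := second_form_quad nux xi U1o Xs Uu.
have q2 xi := second_form_quad nuz xi U2o Zs Uv.
exact: (contact_algebra Jxf Jzf (second_form_sym nux U1o Xs Uu) (second_form_sym nuz U2o Zs Uv)
  nux1 Jnux nuz1 Jnuz chx chz Gx Gz d0 VV abd aabb (fun xi eta => (curves xi eta).1)
  (fun xi eta => (curves xi eta).2) q1 q2).
Qed.
End contact.

(** * Segments, round boundaries and the side of contact *)

Lemma convex_segment (R : realType) (E : lmodType R) (G : set E) (x z : E) (t : R) :
  convex_set (G : set (convex_lmodType E)) -> G x -> G z -> 0 <= t <= 1 ->
  G (x + t *: (z - x)).
Proof.
move=> Gc Gx Gz /andP[t0 t1].
have /set_mem := Gc z x (Itv01 t0 t1) (mem_set Gz) (mem_set Gx).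
congr G; rewrite scalerBr addrCA; congr (_ + _).
rewrite -{2}[x]scale1r -scalerBl //.
Qed.

Lemma symmetric_fun_mono (R : realType) n (G : set 'rV[R]_n) (F : 'rV[R]_n -> R) :
  open G -> convex_set (G : set (convex_lmodType 'rV[R]_n)) -> smooth_on G F ->
  (forall x, G x -> forall i : 'I_n, 0 < 'D_(delta_mx 0 i) F x) ->
  forall x z, G x -> G z -> (forall i, x 0 i <= z 0 i) -> F x <= F z.
Proof.
move=> Go Gc Fs dF x z Gx Gz xz.
have FC := smooth_on_C1 Go Fs.
have [|t t01 E] := @MVT_line _ _ F x (z - x).
  by move=> t /(convex_segment Gc Gx Gz) Gt; have [_ /(_ _ Gt (z - x))[]] := FC.
have Gt := convex_segment Gc Gx Gz t01.
rewrite subrKC in E; rewrite -subr_ge0 E [z - x in X in 'D_X _ _](row_sum_delta (z - x)).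
rewrite (derive_sum_dir _ _ _ FC Gt); apply: sumr_ge0 => i _.
by apply: mulr_ge0; [rewrite !mxE subr_ge0|rewrite ltW// dF].
Qed.

(** A point of the sphere missing from [S] could be joined to a point of the domain by a segment
    that is strictly inside the ball except at its end, hence avoids [S]. The missing point would
    then lie in the domain, against the strict inequality that [domain_ray] gives there. *)
Lemma sphere_boundary (R : realType) m (Om S : set 'rV[R]_m.+1) (y : 'rV[R]_m.+1) (r : R) :
  bounded_domain_of Om S -> S `<=` esphere y r ->
  S = esphere y r /\ forall o, Om o -> enorm (o - y) < r.
Proof.
move=> hOm Sr.
have inr o : Om o -> enorm (o - y) < r.
  by move=> /(domain_ray y hOm)[w Sw]; rewrite (Sr w Sw).
split => //; apply/seteqP; split => // w wr; apply: contrapT => nSw.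
have [_ _ [w0 Ow0] _ _] := hOm.
suff /inr : Om w by rewrite wr ltxx.
apply: (segment_in_domain hOm Ow0) => th /andP[th0 th1] Sth.
have [th1'|th1'] := eqVneq th 1.
  by move: Sth; rewrite th1' subrr scale0r add0r scale1r.
have := Sr _ Sth; rewrite /esphere /=; apply/eqP; rewrite lt_eqF//.
have -> : (1 - th) *: w0 + th *: w - y = (1 - th) *: (w0 - y) + th *: (w - y).
  by apply/rowP => i; rewrite !mxE; ring.
apply: le_lt_trans (ler_enormD _ _) _; rewrite !enormZ (ger0_norm th0) wr.
have th1'' : 0 < 1 - th by rewrite subr_gt0 lt_neqAle th1'.
rewrite gtr0_norm//.
have : (1 - th) * enorm (w0 - y) < (1 - th) * r by rewrite ltr_pM2l// inr.
lra.
Qed.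

(** Moving from [x] towards [w], the distance from [x] scales by [th], while the difference of
    squares scales by [th] up to the nonnegative gain th (1 - th) |x - w|^2. *)
Lemma two_point_segment (R : realType) m (x w y : 'rV[R]_m) (C th : R) :
  2 * C * enorm (x - w) < dot (x - y) (x - y) - dot (w - y) (w - y) -> 0 < th <= 1 ->
  2 * C * enorm (x - ((1 - th) *: x + th *: w)) < dot (x - y) (x - y) -
    dot ((1 - th) *: x + th *: w - y) ((1 - th) *: x + th *: w - y).
Proof.
move=> h /andP[th0 th1]; set w' := (1 - th) *: x + th *: w.
have -> : x - w' = th *: (x - w) by rewrite /w'; apply/rowP => i; rewrite !mxE; ring.
have -> : dot (w' - y) (w' - y) = (1 - th) * dot (x - y) (x - y) + th * dot (w - y) (w - y)
     - th * (1 - th) * dot (x - w) (x - w).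
  have -> : w' - y = (1 - th) *: (x - y) + th *: (w - y).
    by rewrite /w'; apply/rowP => i; rewrite !mxE; ring.
  have -> : x - w = (x - y) - (w - y) by rewrite opprB addrA subrK.
  move: (x - y) (w - y) => P Q.
  by rewrite !dotE (dotC Q P); ring.
rewrite enormZ gtr0_norm//.
have : th * (2 * C * enorm (x - w)) < th * (dot (x - y) (x - y) - dot (w - y) (w - y)).
  by rewrite ltr_pM2l.
have : 0 <= th * (1 - th) * dot (x - w) (x - w).
  by rewrite !mulr_ge0 ?dot_ge0 ?subr_ge0 ?(ltW th0).
lra.
Qed.

(* An outer normal at [z] pointing against [z - c] would let one move [z] out of the
   domain towards [x] along points violating the two-point estimate. *)
Lemma two_point_normal (R : realType) m (Om S : set 'rV[R]_m) (x z y nu V : 'rV[R]_m)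
    (C d : R) :
  bounded_domain_of Om S -> Om x -> 0 < C -> 0 < d -> dot V V = 1 -> x - z = d *: V ->
  dot nu nu = 1 -> (\forall s \near (0 : R)^'+, ~ Om (z + s *: nu)) ->
  (forall w, S w -> dot (x - y) (x - y) - dot (w - y) (w - y) <= 2 * C * enorm (x - w)) ->
  dot (x - y) (x - y) - dot (z - y) (z - y) = 2 * C * d ->
  0 <= dot (z - (y + C *: V)) nu.
Proof.
move=> hOm Ox C0 d0 VV D0 nu1 nuO hle heq; rewrite leNgt; apply/negP.
set k := dot _ nu => k0.
have c0 : 0 < 1 + C / d by rewrite addr_gt0// divr_gt0.
(* For [s] below this value, s (d + C) < - 2 k d: the first-order gain beats the quadratic terms
   left once |x - w| is bounded through [enorm_le_proj]. *)
have s0 : 0 < - (2 * k) / (1 + C / d) by rewrite divr_gt0// oppr_gt0 pmulr_rlt0.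
near (0 : R)^'+ => s.
have sgt0 : 0 < s by [].
have slt : s < - (2 * k) / (1 + C / d) by near: s; exact: nbhs_right_lt.
have nOw : ~ Om (z + s *: nu) by near: s; exact: nuO.
apply: nOw; apply: (segment_in_domain hOm Ox) => th /andP[th0 th1] Sw.
have [th00|th00] := eqVneq th 0.
  by apply: (domain_disjoint hOm Ox); move: Sw; rewrite th00 subr0 scale1r scale0r addr0.
have tht : 0 < th <= 1 by rewrite lt_neqAle eq_sym th00 th0.
have := hle _ Sw; apply/negP; rewrite -ltNge; apply: two_point_segment tht.
set w := z + s *: nu.
have := enorm_le_proj (x - w) d0.
have -> : dot (x - w) (x - w) = d ^+ 2 - 2 * s * d * dot V nu + s ^+ 2.
  have -> : x - w = d *: V - s *: nu by rewrite /w opprD addrA D0.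
  by rewrite !dotE VV nu1 (dotC nu V); ring.
have -> : dot (w - y) (w - y) = dot (z - y) (z - y) + 2 * s * dot (z - y) nu + s ^+ 2.
  have -> : w - y = (z - y) + s *: nu by rewrite /w addrAC.
  by move: (z - y) => P; rewrite !dotE nu1 (dotC nu P); ring.
have kE : k = dot (z - y) nu - C * dot V nu by rewrite /k !dotE; ring.
have {}slt : s * (d + C) < - (2 * k) * d.
  have -> : d + C = (1 + C / d) * d by field; rewrite gt_eqF.
  by rewrite mulrA (ltr_pM2r d0) -ltr_pdivlMr.
move: (enorm (x - w)) (dot V nu) (dot (z - y) nu) kE heq.
move: (dot (x - y) (x - y)) (dot (z - y) (z - y)) => P Q E vn zn kE heq h.
have h2 : 2 * E * d * C <= (d ^+ 2 - 2 * s * d * vn + s ^+ 2 + d ^+ 2) * C by rewrite ler_pM2r.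
have h3 : s * (s * (d + C)) < s * (- (2 * k) * d) by rewrite ltr_pM2l.
rewrite -(ltr_pM2r d0).
have -> : P = 2 * C * d + Q by lra.
subst k; nra.
Unshelve. all: by end_near. Qed.

Lemma is_derive_shift_cst (R : realType) (W : normedModType R) (f : R -> W) (t h : R) df :
  is_derive (t - h) (1 : R) f df -> is_derive t (1 : R) (fun u => f (u - h)) df.
Proof.
move=> [hf fE].
have E k : f (k *: 1 + (t - h)) = (fun u => f (u - h)) (k *: 1 + t) by rewrite /= addrA.
have [dE hd] := @derive_along _ _ _ _ f (fun u => f (u - h)) (t - h) 1 t 1 E.
by split; [exact: hd|rewrite -dE].
Qed.

(** The time coordinate attains its minimum on the compact set where [f] is nonnegative. *)
Lemma compact_first_time (R : realType) (M : topologicalType) (f : M * M * R -> R) a b p q :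
  compact [set: M] -> continuous f -> a <= b -> 0 <= f ((p, q), b) ->
  exists p' q' t, [/\ a <= t <= b, 0 <= f ((p', q'), t) &
    forall p q u, a <= u < t -> f ((p, q), u) < 0].
Proof.
move=> Mc fc ab fb.
pose K := (([set: M] `*` [set: M]) `*` `[a, b]) `&` f @^-1` [set x | 0 <= x].
have Kc : compact K.
  apply: compact_closedI.
    by apply: compact_setX; [exact: compact_setX|exact: segment_compact].
  by apply: (closed_comp (fun x _ => fc x)); exact: closed_ge.
have K0 : K !=set0.
  by exists ((p, q), b); split => //; split => //=; rewrite in_itv /= ab lexx.
have sc : {within K, continuous (snd : M * M * R -> R)}.
  by apply: continuous_subspaceT => x; exact: cvg_snd.
have [[[p' q'] t]] := compact_EVT_min K0 Kc sc.
rewrite inE => -[[_ /=]]; rewrite in_itv /= => tab ft tmin.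
exists p', q', t; split => // p1 q1 u /andP[au ut]; rewrite ltNge; apply/negP => fu.
have : ((p1, q1), u) \in K.
  rewrite inE; split => //; split => //=; rewrite in_itv /= au /=.
  by case/andP: tab => _; apply: le_trans; exact: ltW.
by move=> /tmin /=; rewrite leNgt ut.
Qed.

(** * The flow *)

Section solution.
Context (R : realType) (n : nat) (M : topologicalType) (A : set (chart R n M))
  (G : set 'rV[R]_n) (F : 'rV[R]_n -> R) (T0 T1 : \bar R)
  (phi : M -> R -> 'rV[R]_n.+1).
Context (hM : closed_connected_manifold A).
Context (F_gt0 : forall x, G x -> 0 < F x).
Context (sol : smooth_embedded_solution A G F T0 T1 phi).
Local Notation I := (open_itv T0 T1).

Definition joint_rep (c : chart R n M) (ut : 'rV[R]_n * R) : 'rV[R]_n.+1 :=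
  phi (chart_inv c ut.1) ut.2.

Definition joint_dom (c : chart R n M) : set ('rV[R]_n * R) :=
  [set ut | chart_cod c ut.1 /\ I ut.2].

Lemma joint_rep_C1 c : A c -> C1_on (joint_dom c) (joint_rep c).
Proof.
move=> Ac; apply: smooth_on_C1; last exact: (solution_smooth sol Ac).
rewrite openE => -[u t] [/= cu It]; exists (chart_cod c, I) => //=.
by split; apply: open_nbhs_nbhs; split => //; [exact: chart_cod_open|exact: open_itv_open].
Qed.

Lemma chart_fun_cvg (c : chart R n M) p :
  chart_dom c p -> chart_fun c @ p --> chart_fun c p.
Proof.
move=> cp; have := @chart_fun_continuous _ _ _ c.
rewrite continuous_open_subspace; last exact: chart_dom_open.
by apply; rewrite inE.
Qed.

Lemma local_rep_C1 c t : A c -> I t -> C1_on (chart_cod c) (local_rep (phi^~ t) c).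
Proof.
move=> Ac It; apply: smooth_on_C1; first exact: chart_cod_open.
exact: (embedding_smooth (solution_embedded sol It) Ac).
Qed.

Lemma solution_cvg p t : I t ->
  (fun pt : M * R => phi pt.1 pt.2) @ (p, t) --> phi p t.
Proof.
move=> It; have [[_ _ /(_ p)[c Ac cp] _] _ _] := hM.
have cpt : joint_dom c (chart_fun c p, t) by split => //; exact: chart_funS.
have [jc _] := solution_smooth sol Ac [::] cpt.
have jcE : phi p t = joint_rep c (chart_fun c p, t) by rewrite /joint_rep/= chart_funK.
apply: cvg_trans (_ : (fun pt : M * R => joint_rep c (chart_fun c pt.1, pt.2)) @ (p, t) --> _).
  apply: near_eq_cvg; have nd : \forall q \near p, chart_dom c q.
    by apply: open_nbhs_nbhs; split => //; exact: chart_dom_open.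
  near=> pt; rewrite /joint_rep /= chart_funK//; near: pt.
  exists (chart_dom c, setT); first by split => //; exact: filterT.
  by move=> [q s] [].
rewrite jcE; apply: (cvg_comp (fun pt : M * R => (chart_fun c pt.1, pt.2)) (joint_rep c)); last exact: jc.
apply: (@cvg_pair _ _ _ (nbhs (p, t)) (nbhs (chart_fun c p)) (nbhs t)); last exact: cvg_snd.
apply: (cvg_comp fst (chart_fun c)); first exact: cvg_fst.
exact: chart_fun_cvg.
Unshelve. all: by end_near. Qed.

Lemma solution_is_derive p t : I t -> is_derive t 1 (phi p) (derive1 (phi p) t).
Proof.
move=> It; have [[_ _ /(_ p)[c Ac cp] _] _ _] := hM.
have cpt : joint_dom c (chart_fun c p, t) by split => //; exact: chart_funS.
have [_ /(_ _ cpt (0, 1))[dj _]] := joint_rep_C1 Ac.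
rewrite derive1E; apply: derivableP; move: dj.
apply: (@derive_along _ _ _ _ (joint_rep c) (phi p) (chart_fun c p, t) (0, 1) t 1 _).2 => h.
by rewrite /joint_rep /= scaler0 add0r chart_funK.
Qed.

Lemma joint_rep_derive c p t w (sg : R) : A c -> chart_dom c p -> I t ->
  'D_(w, sg) (joint_rep c) (chart_fun c p, t) =
  w *m 'J (local_rep (phi^~ t) c) (chart_fun c p) + sg *: derive1 (phi p) t.
Proof.
move=> Ac cp It.
have cpt : joint_dom c (chart_fun c p, t) by split => //; exact: chart_funS.
have jC := joint_rep_C1 Ac.
have -> : (w, sg) = (w, 0) + sg *: (0, 1) :> 'rV[R]_n * R.
  by congr pair; rewrite /= ?scaler0 ?addr0// add0r [_ *: _]mulr1.
rewrite (C1_rowP jC cpt).1 deriveZdir; last by have [_ /(_ _ cpt (0, 1))[]] := jC.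
congr (_ + _ *: _).
  rewrite (jacobian_C1 _ (local_rep_C1 Ac It)); last exact: chart_funS.
  apply: (@derive_along _ _ _ _ (joint_rep c) (local_rep (phi^~ t) c) _ (w, 0) _ w _).1 => h.
  by rewrite /joint_rep /= scaler0 add0r.
rewrite derive1E.
apply: (@derive_along _ _ _ _ (joint_rep c) (phi p) _ (0, 1) t 1 _).1 => h.
by rewrite /joint_rep /= scaler0 add0r chart_funK.
Qed.

(** * Expansion of the flow over short times *)

(** The point [h * s] below the surface along the normal is in the domain, and phi(p, t - h) differs
    from it by o(h). The segment joining them stays at normal depth of order h, whereas nearby
    points of M_t have normal component o(h). *)
Lemma past_in_domain_near t p Om nu (s : R) : I t ->
  bounded_domain_of Om (range (phi^~ t)) ->
  outward_unit_normal A (phi^~ t) Om p nu ->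
  0 < s -> derive1 (phi p) t = s *: nu ->
  exists2 d : R, 0 < d & forall h, 0 < h < d -> Om (phi p (t - h)).
Proof.
move=> It hOm [nu1 nuT nuO] s0 vE.
have [[_ _ /(_ p)[c Ac cp] _] _ _] := hM.
pose N : R := n.+1%:R; have N0 : 0 < N by [].
(* With [e] and [e'], the time error and the deviation of M_t from its tangent plane each cost at
   most s h / 4 in the normal direction, less in total than the depth s h. *)
pose e := Order.min 1 (s / (4 * N)).
have e0 : 0 < e by rewrite lt_min ltr01 divr_gt0// mulr_gt0.
pose e' := s / (4 * (s + 1)).
have e'0 : 0 < e' by rewrite divr_gt0// mulr_gt0// addr_gt0.
have [r r0 hr] := embedding_near_tangent (solution_embedded sol It) Ac cp nu1 (nuT c Ac cp) e'0.
have [d d0 hd] := is_derive_near (solution_is_derive p It) e0.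
have [k k0 hk] : exists2 k : R, 0 < k & forall sg, 0 < sg < k -> Om (phi p t - sg *: nu).
  move: nuO; rewrite /at_right /within /= => /nbhs_ballP[k /= k0 hk]; exists k => // sg /andP[sg0 sgk].
  apply: (hk sg _ sg0).1.
  by rewrite -ball_normE /= sub0r normrN gtr0_norm.
have s1 : 0 < s + 1 by rewrite addr_gt0.
exists (Order.min d (Order.min (k / s) (r / (s + 1)))).
  by rewrite !lt_min d0 !divr_gt0.
move=> h /andP[h0]; rewrite !lt_min !ltr_pdivlMr// => /and3P[hd' hk' hr'].
set x0 := phi p t in hr hk *.
have {}hk : Om (x0 - (h * s) *: nu) by apply: hk; rewrite hk' mulr_gt0.
set E := phi p (t - h) - x0 + (h * s) *: nu.
have hE : `|E| <= e * h.
  have := hd (- h); rewrite normrN gtr0_norm// => /(_ hd').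
  by rewrite scaleNr opprK vE scalerA.
apply: (segment_in_domain hOm hk) => th /andP[th0 th1] [q _ qE].
have {}qE : phi q t - x0 = th *: E - (h * s) *: nu.
  by rewrite qE /E; apply/rowP => i; rewrite !mxE; ring.
have nu_le := enorm1_norm_le1 nu1.
have eh : e <= 1 by rewrite ge_min lexx.
have eN : e * N <= s / 4.
  by rewrite -ler_pdivlMr// -mulrA -invfM ge_min lexx orbT.
have thE : `|th *: E| <= e * h.
  by rewrite normrZ ger0_norm//; apply: le_trans hE; rewrite ler_piMl.
have nD : `|phi q t - x0| <= (s + 1) * h.
  rewrite qE; apply: le_trans (ler_normB _ _) _.
  rewrite [X in _ + X]normrZ [`|h * s|]gtr0_norm ?mulr_gt0//.
  have : h * s * `|nu| <= h * s by rewrite ler_piMr// mulr_ge0// ltW.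
  have : e * h <= 1 * h by rewrite ler_pM2r.
  lra.
have := hr q; rewrite -/x0 => /(_ _).
have lt1 : `|phi q t - x0| < r by apply: le_lt_trans nD _; rewrite mulrC.
move=> /(_ lt1); apply/negP; rewrite -ltNge.
apply: (@le_lt_trans _ _ (s / 4 * h)).
  have : e' * `|phi q t - x0| <= e' * ((s + 1) * h) by rewrite ler_wpM2l// ltW.
  move=> /le_trans; apply.
  rewrite /e' le_eqVlt; apply/orP; left; apply/eqP; field.
  by rewrite gt_eqF.
rewrite qE dotDl dotNl (dotZl (h * s)) -enorm_sqr nu1 expr1n mulr1.
have : `|dot (th *: E) nu| <= s / 4 * h.
  apply: le_trans (norm_dot_le _ _) _.
  apply: (@le_trans _ _ (N * (e * h))); last first.
    by rewrite mulrA (mulrC N) ler_wpM2r// ltW.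
  rewrite ler_wpM2l// -[leRHS]mulr1 ler_pM//.
rewrite ler_norml => /andP[_ h1].
rewrite ltr_normr; apply/orP; right.
have : 0 < s * h by rewrite mulr_gt0.
lra.
Qed.

(** The space-time derivative is injective, because the velocity is a nonzero multiple of the
    normal; strict differentiability turns this into injectivity on a ball. *)
Lemma joint_rep_injective_near c p t nu (s : R) : A c -> chart_dom c p -> I t ->
  enorm nu = 1 -> 'J (local_rep (phi^~ t) c) (chart_fun c p) *m nu^T = 0 ->
  0 < s -> derive1 (phi p) t = s *: nu ->
  exists2 r : R, 0 < r & forall y z : 'rV[R]_n * R,
    `|y - (chart_fun c p, t)| < r -> `|z - (chart_fun c p, t)| < r ->
    joint_rep c y = joint_rep c z -> y = z.
Proof.
move=> Ac cp It nu1 Jnu s0 vE.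
set J := 'J _ _ in Jnu.
have [k k0 hk] := row_free_lower_bound (embedding_immersion (solution_embedded sol It) Ac cp).
rewrite -/J in hk.
pose N : R := n.+1%:R; have N0 : 0 < N by [].
have nu_le := enorm1_norm_le1 nu1.
(* The normal component controls the time increment with constant [N / s]; what remains is
   tangential and controls the space increment with constant [(N + 1) / k]. *)
pose C : R := Order.max (N / s) ((N + 1) / k).
have C0 : 0 < C by rewrite lt_max divr_gt0.
have lb (v : 'rV[R]_n * R) : `|v| <= C * `|v.1 *m J + v.2 *: (s *: nu)|.
  set Z := _ + _.
  have dotZ : dot Z nu = v.2 * s.
    rewrite /Z dotDl dot_mulmx -[nu *m _]trmxK trmx_mul trmxK Jnu trmx0 dotC dot0l add0r.
    by rewrite !dotZl -enorm_sqr nu1 expr1n mulr1.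
  have h2 : `|v.2| * s <= N * `|Z|.
    rewrite -[s]gtr0_norm// -normrM -dotZ; apply: le_trans (norm_dot_le _ _) _.
    by rewrite ler_wpM2l// -[leRHS]mulr1 ler_pM.
  have h1 : k * `|v.1| <= (N + 1) * `|Z|.
    apply: le_trans (hk _) _.
    have -> : v.1 *m J = Z - v.2 *: (s *: nu) by rewrite /Z addrK.
    apply: le_trans (ler_normB _ _) _; rewrite mulrDl mul1r addrC lerD2r.
    rewrite !normrZ (gtr0_norm s0) mulrA; apply: le_trans h2.
    by rewrite ler_piMr// mulr_ge0// ltW.
  have Z0 : 0 <= `|Z| by [].
  rewrite prod_normE /= ge_max; apply/andP; split.
    rewrite -ler_pdivlMl// in h1; apply: le_trans h1 _.
    by rewrite mulrA ler_wpM2r// mulrC le_max lexx orbT.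
  rewrite -ler_pdivlMr// in h2; apply: le_trans h2 _.
  by rewrite mulrAC ler_wpM2r// le_max lexx.
have e0 : 0 < (2 * C)^-1 by rewrite invr_gt0 mulr_gt0.
have cpt : joint_dom c (chart_fun c p, t) by split => //; exact: chart_funS.
have [r r0 hr] := strict_diff_row (@joint_basisP _ _) (@joint_coord_le _ _)
  (joint_rep_C1 Ac) cpt e0.
exists r => // y z yr zr jyz; apply/eqP; rewrite -subr_eq0 -normr_eq0 eq_le normr_ge0 andbT.
have := hr y z yr zr; rewrite jyz subrr sub0r normrN => h.
have E := joint_rep_derive (y - z).1 (y - z).2 Ac cp It.
rewrite -surjective_pairing -/J vE in E; rewrite E in h.
have := lb (y - z); set a := `|y - z| in h *; set b := `|_ + _| in h *.
have {}h : C * b <= 2^-1 * a.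
  have : C * b <= C * ((2 * C)^-1 * a) by rewrite ler_pM2l.
  move=> /le_trans; apply; rewrite le_eqVlt; apply/orP; left; apply/eqP; field.
  by rewrite gt_eqF.
lra.
Qed.

Lemma solution_near_box (p : M) t (e : R) : I t -> 0 < e ->
  exists2 U : set M, nbhs p U & exists2 d : R, 0 < d &
    forall q s, U q -> `|s - t| < d -> `|phi q s - phi p t| < e.
Proof.
move=> It e0; have /cvgrPdist_lt/(_ e e0) := solution_cvg (p := p) It.
move=> [[U V] /= [Up /nbhs_ballP[d d0 hd]] UV].
exists U => //; exists d => // q s Uq sd; rewrite distrC.
apply: (UV (q, s)); split => //=; apply: hd.
by rewrite -ball_normE /= distrC.
Qed.

(** Points with distinct images at time [t] are kept apart by continuity; otherwise they coincide,
    and local injectivity in space-time excludes equal images at different times. *)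
Lemma solution_disjoint_near (p q : M) t : I t ->
  exists U V : set M, [/\ nbhs p U, nbhs q V & exists2 d : R, 0 < d &
    forall p' q' s s', U p' -> V q' -> `|s - t| < d -> `|s' - t| < d -> s != s' ->
      phi p' s <> phi q' s'].
Proof.
move=> It; have [pq|pq] := eqVneq (phi p t) (phi q t); last first.
  have e0 : 0 < `|phi p t - phi q t| / 2 by rewrite divr_gt0// normr_gt0 subr_eq0.
  have [U Up [d d0 hd]] := @solution_near_box p t _ It e0.
  have [V Vq [d' d'0 hd']] := @solution_near_box q t _ It e0.
  exists U, V; split => //; exists (Order.min d d'); first by rewrite lt_min d0.
  move=> p' q' s s' Up' Vq'; rewrite !lt_min => /andP[sd _] /andP[_ sd'] _ E.
  have h1 := hd _ _ Up' sd; have h2 := hd' _ _ Vq' sd'.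
  have : `|phi p t - phi q t| <= `|phi q' s' - phi q t| + `|phi p' s - phi p t|.
    have -> : phi p t - phi q t = (phi q' s' - phi q t) - (phi p' s - phi p t).
      by rewrite E; apply/rowP => i; rewrite !mxE; ring.
    exact: ler_normB.
  lra.
have {}pq : p = q by apply: (embedding_injective (solution_embedded sol It)).
subst q.
have [[_ _ /(_ p)[c Ac cp] _] _ _] := hM.
have [Om hOm /(_ p)[nu [lam [[nu1 nuT _] _ Glam vE]]]] := solution_flow sol It.
have s0 : 0 < (F lam)^-1 by rewrite invr_gt0; exact: F_gt0.
have [r r0 hr] := joint_rep_injective_near Ac cp It nu1 (nuT c Ac cp) s0 vE.
pose U := chart_dom c `&` [set q | `|chart_fun c q - chart_fun c p| < r].
have Up : nbhs p U.
  apply: filterI; first by apply: open_nbhs_nbhs; split => //; exact: chart_dom_open.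
  have /cvgrPdist_lt/(_ r r0) := chart_fun_cvg cp.
  by apply: filterS => q /=; rewrite distrC.
exists U, U; split => //; exists r => // p' q' s s' [cp' rp'] [cq' rq'] sr s'r ss' E.
have := hr (chart_fun c p', s) (chart_fun c q', s').
rewrite !prod_normE /= !gt_max rp' rq' sr s'r /joint_rep /= !chart_funK// => /(_ isT isT E) [_].
by apply/eqP.
Qed.

Lemma solution_disjoint a b : (forall t, a <= t <= b -> I t) ->
  exists2 eta : R, 0 < eta & forall p q s t, a <= s -> t <= b -> s < t < s + eta ->
    phi p s <> phi q t.
Proof.
move=> abI.
pose K := ([set: M] `*` [set: M]) `*` `[a, b].
have Kc : compact K.
  have [_ Mc _] := hM.
  by apply: compact_setX; [exact: compact_setX|exact: segment_compact].
pose P (eta : R) (x : M * M * R) := forall t, t <= b -> x.2 < t < x.2 + eta ->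
  phi x.1.1 x.2 <> phi x.1.2 t.
have : \forall eta \near (0 : R)^'+, K `<=` P eta.
  apply: (compact_near_coveringP K).1 => //.
  move=> [[p q] t] [_ /=]; rewrite in_itv /= => /abI It.
  have [U [V [Up Vq [d d0 hd]]]] := @solution_disjoint_near p q t It.
  have d2 : 0 < d / 2 by rewrite divr_gt0.
  (* Half of [d] is spent on the base time and half on the gap, so both times stay within [d] of
     [t]. *)
  exists ((U `*` V) `*` [set s | `|s - t| < d / 2], [set eta | eta < d / 2]) => /=.
    split; last exact: nbhs_right_lt.
    exists (U `*` V, [set s | `|s - t| < d / 2]) => //; split => /=; first by exists (U, V).
    by apply/nbhs_ballP; exists (d / 2) => // y; rewrite -ball_normE /= distrC.
  move=> [[[p' q'] s] eta] [/= [[Up' Vq'] st] etad] s' s'b /= /andP[ss' s's].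
  apply: hd => //; [lra|rewrite ltr_norml; move: st; rewrite ltr_norml|].
    by move=> /andP[? ?]; apply/andP; split; lra.
  by rewrite lt_eqF.
rewrite /at_right /within /= => /nbhs_ballP[r /= r0 hr].
have r2 : 0 < r / 2 by rewrite divr_gt0.
exists (r / 2) => // p q s t as_ tb st.
have : K `<=` P (r / 2) by apply: hr => //; rewrite -ball_normE /= sub0r normrN gtr0_norm//; lra.
move=> /(_ ((p, q), s)); apply => //; split => //=; rewrite in_itv /= as_ /=.
by case/andP: st => /ltW st _; exact: le_trans st tb.
Qed.

(** The trajectory of [p] on [s, t) is connected and misses M_t, and close to time t it lies in the
    domain; so it lies there entirely. *)
Lemma past_in_domain a b : (forall t, a <= t <= b -> I t) ->
  exists2 eta : R, 0 < eta & forall p s t Om, a <= s -> t <= b -> s < t < s + eta ->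
    bounded_domain_of Om (range (phi^~ t)) ->
    (forall p, exists nu lam,
        [/\ outward_unit_normal A (phi^~ t) Om p nu, G lam
          & derive1 (phi p) t = (F lam)^-1 *: nu]) ->
    Om (phi p s).
Proof.
move=> abI; have [eta eta0 heta] := solution_disjoint abI; exists eta => //.
move=> p s t Om as_ tb /andP[st ts] hOm /(_ p)[nu [lam [hnu Glam vE]]].
have It : I t by apply: abI; rewrite tb andbT (le_trans as_)// ltW.
have s0 : 0 < (F lam)^-1 by rewrite invr_gt0; exact: F_gt0.
have [d d0 hd] := past_in_domain_near It hOm hnu s0 vE.
suff : phi p @` `[s, t[ `<=` Om by apply; exists s => //=; rewrite in_itv/= lexx.
apply: (connected_in_domain hOm).
- apply: connected_continuous_connected; first exact/connected_intervalP/interval_is_interval.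
  apply: derivable_within_continuous => u; rewrite in_itv /= => /andP[su ut].
  have Iu : I u by apply: abI; rewrite (le_trans as_)//= (le_trans (ltW ut)).
  by have [] := solution_is_derive p Iu.
- pose h := Order.min (d / 2) (t - s).
  have h0 : 0 < h by rewrite lt_min divr_gt0// subr_gt0.
  exists (phi p (t - h)); split; last first.
    by apply: hd; rewrite h0 gt_min; apply/orP; left; lra.
  exists (t - h) => //=; rewrite in_itv /=; apply/andP; split; last lra.
  have : h <= t - s by rewrite ge_min lexx orbT.
  lra.
- move=> _ [u + <-] [q _ E]; rewrite /= in_itv /= => /andP[su ut].
  apply: (heta p q u t) => //; first exact: le_trans su.
  by rewrite ut /=; lra.
Qed.

Lemma past_in_flow_domain a b : (forall t, a <= t <= b -> I t) ->
  exists2 eta : R, 0 < eta & forall s t, a <= s -> t <= b -> s < t < s + eta ->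
    exists Om, [/\ bounded_domain_of Om (range (phi^~ t)), forall p, Om (phi p s) &
      forall p, exists nu lam,
        [/\ outward_unit_normal A (phi^~ t) Om p nu,
            principal_curvatures A (phi^~ t) p nu lam, G lam
          & derive1 (phi p) t = (F lam)^-1 *: nu] ].
Proof.
move=> abI; have [eta eta0 heta] := past_in_domain abI.
exists eta => // s t as_ tb st.
have It : I t by apply: abI; rewrite tb andbT (le_trans as_)//; case/andP: st => /ltW.
have [Om hOm hnu] := solution_flow sol It.
exists Om; split => // p; apply: heta as_ tb st hOm _ => q.
by have [nu [lam [h1 _ h3 h4]]] := hnu q; exists nu, lam.
Qed.

(** The interval is cut into steps shorter than [eta]; in each, the earlier point lies in the later
    domain, and [domain_ray] finds a farther boundary point. *)
Lemma distance_increasing a b (y : 'rV[R]_n.+1) p : a <= b -> (forall t, a <= t <= b -> I t) ->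
  exists q, enorm (phi p a - y) <= enorm (phi q b - y).
Proof.
move=> ab abI; have [eta eta0 heta] := past_in_flow_domain abI.
have [N hN] : exists N : nat, (b - a) < N.+1%:R * eta.
  exists (Num.truncn ((b - a) / eta)); rewrite -ltr_pdivrMr//.
  by rewrite truncnS_gt.
pose h := (b - a) / N.+1%:R.
have h_ge0 : 0 <= h by rewrite divr_ge0// subr_ge0.
have hlt : h < eta by rewrite /h ltr_pdivrMr// mulrC.
have bE : b = a + N.+1%:R * h by rewrite /h mulrC divfK// addrC subrK.
have step k : (k <= N.+1)%N -> exists q, enorm (phi p a - y) <= enorm (phi q (a + k%:R * h) - y).
  elim: k => [_|k IH kN]; first by exists p; rewrite mul0r addr0.
  have [q hq] := IH (ltnW kN).
  have [h0|h0] := eqVneq h 0; first by exists q; move: hq; rewrite h0 !mulr0.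
  have hpos : 0 < h by rewrite lt_neqAle eq_sym h0.
  have [|||Om [hOm Oq _]] := heta (a + k%:R * h) (a + k.+1%:R * h).
  - by rewrite lerDl mulr_ge0.
  - by rewrite bE lerD2l ler_pM2r// ler_nat.
  - by rewrite ltrD2l ltr_pM2r// ltr_nat ltnSn/= -addrA ltrD2l -natr1 mulrDl mul1r ltrD2l.
  have [w [q' _ <-] hw] := domain_ray y hOm (Oq q).
  by exists q'; exact: le_trans hq (ltW hw).
have [q hq] := step N.+1 (leqnn _).
by exists q; rewrite bE.
Qed.

(** * The two-point estimate *)

Context (G_open : open G) (G_convex : convex_set (G : set (convex_lmodType 'rV[R]_n))).
Context (G_sym : symmetric_set G) (F_smooth : smooth_on G F) (F_sym : symmetric_fun_on G F).
Context (dF_gt0 : forall x, G x -> forall i : 'I_n, 0 < 'D_(delta_mx 0 i) F x).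

(** The contradiction at a first contact: [contact_time] forces k / F(lamx) - k' / F(lamz) to be
    positive, while [contact_geometry] and [two_point_normal] make it nonpositive. *)
Lemma two_point_contact (y : 'rV[R]_n.+1) p q s t (C : R -> R) (C1 d0 h : R) Om :
  I s -> I t -> s = t - h -> 0 < d0 ->
  bounded_domain_of Om (range (phi^~ t)) -> Om (phi p s) ->
  (exists nu lam,
     [/\ outward_unit_normal A (phi^~ t) Om q nu,
         principal_curvatures A (phi^~ t) q nu lam, G lam
       & derive1 (phi q) t = (F lam)^-1 *: nu]) ->
  is_derive t (1 : R) C C1 -> 0 < C t -> 0 < C1 ->
  (forall k, 0 < k < d0 -> 0 <= C (t - k)) ->
  (forall k, 0 < k < d0 -> dot (phi p (s - k) - y) (phi p (s - k) - y)
     - dot (phi q (t - k) - y) (phi q (t - k) - y)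
     <= 2 * C (t - k) * enorm (phi p (s - k) - phi q (t - k))) ->
  (forall p' q', dot (phi p' s - y) (phi p' s - y) - dot (phi q' t - y) (phi q' t - y)
     <= 2 * C t * enorm (phi p' s - phi q' t)) ->
  dot (phi p s - y) (phi p s - y) - dot (phi q t - y) (phi q t - y) =
    2 * C t * enorm (phi p s - phi q t) -> False.
Proof.
move=> Is It sE d00 hOm Op [nuz [lamz [[nuz1 nuzT nuzO] chz Gz vz]]] hC Ct C10 Cge0 hleft hmax heq.
have [[_ _ Mcov _] _ _] := hM.
have [cx Acx cpx] := Mcov p; have [cz Acz cqz] := Mcov q.
have [Omx _ /(_ p)[nux [lamx [[nux1 nuxT _] chx Gx vx]]]] := solution_flow sol Is.
have xz : phi p s - phi q t != 0.
  rewrite subr_eq0; apply/eqP => E; apply: (domain_disjoint hOm Op).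
  by exists q.
set d := enorm (phi p s - phi q t) in heq.
have dpos : 0 < d by rewrite enorm_gt0.
pose V := d^-1 *: (phi p s - phi q t).
have VV : dot V V = 1 by rewrite /V dotZl dotZr -enorm_sqr -/d; field; rewrite gt_eqF.
have D0 : phi p s - phi q t = d *: V by rewrite /V scalerA divff ?gt_eqF// scale1r.
have Xp : local_rep (phi^~ s) cx (chart_fun cx p) = phi p s by rewrite /local_rep /= chart_funK.
have Zq : local_rep (phi^~ t) cz (chart_fun cz q) = phi q t by rewrite /local_rep /= chart_funK.
have embx := solution_embedded sol Is; have embz := solution_embedded sol It.
have F_mono := symmetric_fun_mono G_open G_convex F_smooth dF_gt0.
have [k [k' [aE bE kk k0 [kpos kneg]]]] :
  exists k k' : R, [/\ phi p s - (y + C t *: V) = k *: nux, phi q t - (y + C t *: V) = k' *: nuz,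
    k ^+ 2 = k' ^+ 2, k != 0
    & (0 < k -> k = k' -> F lamz <= F lamx) /\ (k < 0 -> k = k' -> F lamx <= F lamz)].
  have hle u' v' : chart_cod cx u' -> chart_cod cz v' ->
     dot (local_rep (phi^~ s) cx u' - y) (local_rep (phi^~ s) cx u' - y) -
     dot (local_rep (phi^~ t) cz v' - y) (local_rep (phi^~ t) cz v' - y)
     <= 2 * C t * enorm (local_rep (phi^~ s) cx u' - local_rep (phi^~ t) cz v').
    by move=> _ _; exact: hmax.
  have D0' : local_rep (phi^~ s) cx (chart_fun cx p) - local_rep (phi^~ t) cz (chart_fun cz q) = d *: V.
    by rewrite Xp Zq.
  have heq' : dot (local_rep (phi^~ s) cx (chart_fun cx p) - y) (local_rep (phi^~ s) cx (chart_fun cx p) - y) -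
     dot (local_rep (phi^~ t) cz (chart_fun cz q) - y) (local_rep (phi^~ t) cz (chart_fun cz q) - y)
     = 2 * C t * enorm (local_rep (phi^~ s) cx (chart_fun cx p) - local_rep (phi^~ t) cz (chart_fun cz q)).
    by rewrite Xp Zq.
  have := contact_geometry G_sym F_sym F_mono (@chart_cod_open _ _ _ cx)
    (embedding_smooth embx Acx) (chart_funS cpx) (embedding_immersion embx Acx cpx)
    (@chart_cod_open _ _ _ cz)
    (embedding_smooth embz Acz) (chart_funS cqz) (embedding_immersion embz Acz cqz)
    nux1 (nuxT cx Acx cpx) nuz1 (nuzT cz Acz cqz) (chx cx Acx cpx) (chz cz Acz cqz)
    Gx Gz Ct dpos VV D0' hle heq'.
  by rewrite Xp Zq.
have hx : is_derive t (1 : R) (fun u => phi p (u - h)) ((F lamx)^-1 *: nux).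
  by apply: is_derive_shift_cst; rewrite -sE -vx; exact: (solution_is_derive p Is).
have hz : is_derive t (1 : R) (phi q) ((F lamz)^-1 *: nuz).
  by rewrite -vz; exact: (solution_is_derive q It).
have D0s : phi p (t - h) - phi q t = d *: V by rewrite -sE.
have hleft' k0' : 0 < k0' < d0 -> dot (phi p (t - k0' - h) - y) (phi p (t - k0' - h) - y)
     - dot (phi q (t - k0') - y) (phi q (t - k0') - y)
     <= 2 * C (t - k0') * enorm (phi p (t - k0' - h) - phi q (t - k0')).
  by move=> hk; rewrite (addrAC t) -sE; exact: hleft.
have heqs : dot (phi p (t - h) - y) (phi p (t - h) - y) - dot (phi q t - y) (phi q t - y) =
    2 * C t * enorm (phi p (t - h) - phi q t) by rewrite -sE.
have := contact_time d00 dpos VV D0s hx hz hC Cge0 hleft' heqs.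
rewrite -sE aE bE !dotZl !dotZr -!enorm_sqr nux1 nuz1 !expr1n !mulr1.
have sx : 0 < (F lamx)^-1 by rewrite invr_gt0; exact: F_gt0.
have sz : 0 < (F lamz)^-1 by rewrite invr_gt0; exact: F_gt0.
have Cd : 0 < C1 * d by rewrite mulr_gt0.
move=> /(lt_le_trans Cd); rewrite subr_gt0.
have k'_ge0 : 0 <= k'.
  have nuz11 : dot nuz nuz = 1 by rewrite -enorm_sqr nuz1 expr1n.
  have nO : \forall u \near (0 : R)^'+, ~ Om (phi q t + u *: nuz).
    by apply: filterS nuzO => u [_ nc] Oc; apply: nc; exact: subset_closure.
  have Sle w : range (phi^~ t) w -> dot (phi p s - y) (phi p s - y) - dot (w - y) (w - y)
     <= 2 * C t * enorm (phi p s - w) by move=> [q' _ <-]; exact: hmax.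
  have := two_point_normal hOm Op Ct dpos VV D0 nuz11 nO Sle heq.
  by rewrite bE dotZl nuz11 mulr1.
(* For k = k' > 0 the order of the curvatures decides; for k = - k' the term at x is nonpositive and
   the term at z nonnegative. *)
move/eqP: kk; rewrite eqf_sqr => /orP[/eqP kk'|/eqP kk'].
- have k'0 : 0 < k' by rewrite lt_neqAle k'_ge0 andbT -kk' eq_sym.
  rewrite kk' (ltr_pM2l k'0) ltf_pV2 ?posrE ?F_gt0//.
  by rewrite ltNge kpos// kk'.
- apply/negP; rewrite -leNgt kk' mulNr (@le_trans _ _ 0)//.
    by rewrite oppr_le0 mulr_ge0// ltW.
  by rewrite mulr_ge0// ltW.
Qed.

Definition two_point (y : 'rV[R]_n.+1) (C : R -> R) (h : R) (p q : M) (t : R) : R :=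
  dot (phi p (t - h) - y) (phi p (t - h) - y) - dot (phi q t - y) (phi q t - y) -
  2 * C t * enorm (phi p (t - h) - phi q t).

(** As [phi] is constrained only on the time interval, time is passed through a map [g] landing
    where both slices exist. This gives the continuity on the whole product that
    [compact_first_time] asks for. *)
Lemma two_point_continuous y C h (g : R -> R) :
  continuous C -> continuous g -> (forall u, I (g u) /\ I (g u - h)) ->
  continuous (fun x : M * M * R => two_point y C h x.1.1 x.1.2 (g x.2)).
Proof.
move=> Cc gc gI x0; set t := g x0.2.
have [It Ith] := gI x0.2.
have c2 : (fun x : M * M * R => g x.2) @ x0 --> t.
  by apply: (cvg_comp snd g); [exact: cvg_snd|exact: gc].
have c11 : (fun x : M * M * R => x.1.1) @ x0 --> x0.1.1.
  by apply: (cvg_comp fst fst); [exact: cvg_fst|exact: cvg_fst].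
have c12 : (fun x : M * M * R => x.1.2) @ x0 --> x0.1.2.
  by apply: (cvg_comp fst snd); [exact: cvg_fst|exact: cvg_snd].
have phic (f : M * M * R -> M) (g' : M * M * R -> R) p u : I u ->
    f @ x0 --> p -> g' @ x0 --> u -> (fun x => phi (f x) (g' x)) @ x0 --> phi p u.
  move=> Iu fp gu.
  apply: (cvg_comp (fun x => (f x, g' x)) (fun pt : M * R => phi pt.1 pt.2)).
    exact: (@cvg_pair _ _ _ (nbhs x0) (nbhs p) (nbhs u)).
  exact: (solution_cvg (p := p) Iu).
have c2h : (fun x : M * M * R => g x.2 - h) @ x0 --> t - h.
  by apply: cvgB => //; exact: cvg_cst.
have cx := phic _ _ _ _ Ith c11 c2h; have cz := phic _ _ _ _ It c12 c2.
have cxy : (fun x : M * M * R => phi x.1.1 (g x.2 - h) - y) @ x0 --> phi x0.1.1 (t - h) - y.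
  by apply: cvgB => //; exact: cvg_cst.
have czy : (fun x : M * M * R => phi x.1.2 (g x.2) - y) @ x0 --> phi x0.1.2 t - y.
  by apply: cvgB => //; exact: cvg_cst.
have cxz : (fun x : M * M * R => phi x.1.1 (g x.2 - h) - phi x.1.2 (g x.2)) @ x0 -->
    phi x0.1.1 (t - h) - phi x0.1.2 t by exact: cvgB.
have dx := cvg_dot cxy cxy; have dz := cvg_dot czy czy; have ex := cvg_enorm cxz.
rewrite /two_point; apply: cvgB; first by apply: cvgB; [exact: dx|exact: dz].
apply: cvgM; last exact: ex.
apply: cvgM; first exact: cvg_cst.
by apply: (cvg_comp (fun x : M * M * R => g x.2) C c2); exact: Cc.
Qed.

Lemma two_point_lt (y : 'rV[R]_n.+1) (t0 T r k : R) :
  t0 < T -> (forall t, t0 <= t <= T -> I t) -> 0 < r -> 0 < k ->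
  range (phi^~ t0) `<=` eball y r ->
  exists2 h0 : R, 0 < h0 & forall h, 0 < h < h0 -> forall p q,
    two_point y (fun t => r + k * (t - t0)) h p q T < 0.
Proof.
move=> t0T tI r0 k0 hr.
have [eta eta0 heta] := past_in_flow_domain tI.
(* The shift must be below [eta] for x to lie inside M_t, and below T - t0 for the first comparison
   time t0 + h to precede T. *)
exists (Order.min eta (T - t0)); first by rewrite lt_min eta0 subr_gt0.
move=> h /andP[hpos]; rewrite lt_min => /andP[heta' hT] p0 q0.
rewrite ltNge; apply/negP => bad.
pose C t : R := r + k * (t - t0).
pose g (t : R) := Order.max (t0 + h) (Order.min t T).
have abT : t0 + h <= T by lra.
have gE t : t0 + h <= t <= T -> g t = t.
  by move=> /andP[h1 h2]; rewrite /g (min_idPl h2) (max_idPr h1).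
have gI u : t0 + h <= g u <= T.
  by rewrite /g le_max lexx ge_max abT ge_min lexx orbT.
have Cc : continuous C.
  move=> t; apply: cvgD; first exact: cvg_cst.
  apply: cvgM; first exact: cvg_cst.
  by apply: cvgB; [exact: cvg_id|exact: cvg_cst].
have gc : continuous g.
  move=> t; apply: (@continuous_max _ _ (cst (t0 + h)) (id \min cst T)); first exact: cvg_cst.
  by apply: (@continuous_min _ _ id (cst T)); [exact: cvg_id|exact: cvg_cst].
have gII u : I (g u) /\ I (g u - h).
  by have /andP[h1 h2] := gI u; split; apply: tI; apply/andP; split; lra.
have fc := @two_point_continuous y C h g Cc gc gII.
have bad' : 0 <= (fun x : M * M * R => two_point y C h x.1.1 x.1.2 (g x.2)) ((p0, q0), T).
  by rewrite /= gE ?lexx ?abT.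
have [_ Mc _] := hM.
have [p [q [t [tab]]]] := compact_first_time Mc fc abT bad'.
rewrite /= gE// => ft tmin; have /andP[ta tb] := tab.
have It : I t by apply: tI; rewrite tb andbT; lra.
have Is : I (t - h) by apply: tI; apply/andP; split; lra.
have [Om [hOm Op hnu]] : exists Om, [/\ bounded_domain_of Om (range (phi^~ t)),
     forall p, Om (phi p (t - h)) &
      forall p, exists nu lam,
        [/\ outward_unit_normal A (phi^~ t) Om p nu,
            principal_curvatures A (phi^~ t) p nu lam, G lam
          & derive1 (phi p) t = (F lam)^-1 *: nu] ].
  by apply: heta => //; [lra|apply/andP; split; lra].
have xz p' q' : 0 < enorm (phi p' (t - h) - phi q' t).
  rewrite enorm_gt0 subr_eq0; apply/eqP => E; apply: (domain_disjoint hOm (Op p')).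
  by exists q'.
(* At the initial time x lies in the ball of radius [r], and the factorised difference of squares
   makes the function negative; a contact can only occur later. *)
have [tE|tN] := eqVneq t (t0 + h).
  have xr : enorm (phi p (t - h) - y) < r.
    by rewrite tE addrK; apply: hr; exists p.
  move: ft; apply/negP; rewrite -ltNge /two_point /C subr_lt0.
  set x := phi p (t - h) in xr *; set z := phi q t.
  have hxz : 0 < enorm (x - z) by exact: xz.
  apply: (@lt_le_trans _ _ (2 * r * enorm (x - z))); last first.
    by rewrite ler_pM2r// ler_pM2l// lerDl mulr_ge0 ?(ltW k0)//; lra.
  rewrite -!enorm_sqr.
  have tri : enorm (x - y) <= enorm (x - z) + enorm (z - y).
    have -> : x - y = (x - z) + (z - y) by rewrite addrA subrK.
    exact: ler_enormD.
  have [zx|zx] := leP (enorm (x - y)) (enorm (z - y)).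
    apply: (@le_lt_trans _ _ 0); last by rewrite !mulr_gt0.
    by rewrite subr_le0 ler_pXn2r ?nnegrE ?enorm_ge0.
  have zy0 := enorm_ge0 (z - y).
  move: (enorm (x - y)) (enorm (x - z)) (enorm (z - y)) xr hxz tri zx zy0 => a b c xr hxz tri zx zy0.
  nra.
have tgt : t0 + h < t by rewrite lt_neqAle eq_sym tN.
have before p' q' u : t0 + h <= u < t -> two_point y C h p' q' u < 0.
  move=> /andP[u1 u2]; have := tmin p' q' u; rewrite u1 u2 /= gE; last by rewrite u1 /=; lra.
  exact.
(* Negativity before [t] passes to the limit, so the contact is a spatial maximum with value
   zero. *)
have hmax p' q' : two_point y C h p' q' t <= 0.
  rewrite leNgt; apply/negP => pos.
  have := fc ((p', q'), t) => /cvgrPdist_lt/(_ (two_point y C h p' q' t)).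
  rewrite /= gE// => /(_ pos) [[U V] /= [Upq /nbhs_ballP[e /= e0 he]] UV].
  pose u := Order.max (t0 + h) (t - e / 2).
  have ut : t0 + h <= u < t by rewrite le_max lexx gt_max tgt /=; lra.
  have := UV ((p', q'), u); rewrite /= gE; last first.
    by case/andP: ut => -> /=; lra.
  have Vu : V u.
    apply: he; rewrite -ball_normE /= gtr0_norm ?subr_gt0; last by case/andP: ut.
    by rewrite /u ltrBlDr -ltrBlDl lt_max; apply/orP; right; lra.
  move=> /(_ (conj (nbhs_singleton Upq) Vu)).
  have := before p' q' u ut.
  set v := two_point _ _ _ _ _ u; set w := two_point _ _ _ _ _ t in pos *.
  by move=> v0; rewrite gtr0_norm; lra.
have hC : is_derive t (1 : R) C k.
  have h1 := is_derive_sub_cst t0 (is_derive_id t (1 : R)).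
  have h2 := is_derive_mul (is_derive_cst (k : R) t (1 : R)) h1.
  apply: (is_derive_eq (is_deriveD (is_derive_cst (r : R) t (1 : R)) h2)).
  by rewrite mul0r !add0r mulr1.
have Cpos u : t0 <= u -> 0 < C u.
  by move=> u0; rewrite /C ltr_wpDr// mulr_ge0 ?(ltW k0)// subr_ge0.
have d00 : 0 < t - (t0 + h) by rewrite subr_gt0.
apply: (two_point_contact
  (y := y) (p := p) (q := q) (s := t - h) (t := t) (C := C) (C1 := k) (h := h) Is It erefl d00 hOm (Op p) _ hC _ k0).
- have [nu [lam [? ? ? ?]]] := hnu q; by exists nu, lam.
- by apply: Cpos; lra.
- by move=> u /andP[u0 ud]; rewrite ltW// Cpos//; lra.
- move=> u /andP[u0 ud]; have := before p q (t - u).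
  have uu : t0 + h <= t - u < t by apply/andP; split; lra.
  by move=> /(_ uu); rewrite /two_point subr_lt0 (addrAC t) => /ltW.
- by move=> p' q'; have := hmax p' q'; rewrite /two_point subr_le0.
- by have := hmax p q; move: ft; rewrite /two_point => h1 h2; apply/eqP; rewrite -subr_eq0 eq_le h1 h2.
Qed.

(** * Vanishing shift and roundness *)

(** If [p] were strictly farther from [y] than [q], the unshifted function at time T would be
    positive for small [r], hence also for a small shift, against [two_point_lt]. *)
Lemma equidistant y T p q : comes_out_of T0 T1 phi y -> I T ->
  enorm (phi p T - y) <= enorm (phi q T - y).
Proof.
move=> hout IT; rewrite leNgt; apply/negP => zx.
have x0 : 0 < enorm (phi p T - y) by exact: le_lt_trans (enorm_ge0 _) zx.
have xz : 0 < enorm (phi p T - phi q T).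
  by rewrite enorm_gt0 subr_eq0; apply: contraTneq zx => ->; rewrite ltxx.
set e := enorm (phi p T - phi q T) in xz.
pose del := dot (phi p T - y) (phi p T - y) - dot (phi q T - y) (phi q T - y).
have del0 : 0 < del by rewrite subr_gt0 -lt_enorm.
(* The first bound forces [t0 < T]. The second serves at time T, where [C T = 2 * r]: then 2 C(T) e
   = 4 r e is at most half of [del]. *)
pose r := Order.min (enorm (phi p T - y)) (del / (8 * e)).
have r0 : 0 < r by rewrite lt_min x0 divr_gt0// mulr_gt0.
have r_le : r * (8 * e) <= del by rewrite -ler_pdivlMr ?mulr_gt0// ge_min lexx orbT.
have [t0 It0 ht0] := hout r r0.
have t0T : t0 < T.
  (* A slice after T has a point at least as far from [y] as phi(p, T), so it cannot lie in the ball
     of radius [r]. *)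
  rewrite ltNge; apply/negP => Tt0.
  have TI t : T <= t <= t0 -> I t by exact: open_itv_convex.
  have [q' hq'] := distance_increasing y p Tt0 TI.
  have : enorm (phi q' t0 - y) < r by apply: ht0; exists q'.
  by apply/negP; rewrite -leNgt ge_min hq'.
have tI t : t0 <= t <= T -> I t by exact: open_itv_convex.
have k0 : 0 < r / (T - t0) by rewrite divr_gt0// subr_gt0.
have [h0 h00 hlt] := two_point_lt
  t0T tI r0 k0 ht0.
pose C t := r + r / (T - t0) * (t - t0).
have CT : C T = 2 * r by rewrite /C divfK ?gt_eqF ?subr_gt0//; ring.
pose f u := two_point y C (T - u) p q T.
have fT : 0 < f T.
  rewrite /f /two_point subrr subr0 -/del -/e CT.
  have : r * e * 8 <= del by rewrite -mulrA (mulrC e).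
  have : 0 < r * e by rewrite mulr_gt0.
  lra.
have fc : f @ T --> f T.
  have cp : phi p @ T --> phi p T.
    by apply: differentiable_continuous; apply/derivable1_diffP; have [] := solution_is_derive p IT.
  have cx : (fun u => phi p (T - (T - u))) @ T --> phi p (T - (T - T)).
    under eq_fun do rewrite opprB addrC subrK.
    by rewrite subrr subr0.
  have cy : (fun u => phi p (T - (T - u)) - y) @ T --> phi p (T - (T - T)) - y.
    by apply: cvgB => //; exact: cvg_cst.
  have cz : (fun u => phi p (T - (T - u)) - phi q T) @ T --> phi p (T - (T - T)) - phi q T.
    by apply: cvgB => //; exact: cvg_cst.
  rewrite /f /two_point; apply: cvgB.
    by apply: cvgB; [exact: (cvg_dot cy cy)|exact: cvg_cst].
  by apply: cvgM; [exact: cvg_cst|exact: (cvg_enorm cz)].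
have /cvgrPdist_lt/(_ _ fT)/nbhs_ballP[d /= d0 hd] := fc.
pose h := Order.min (d / 2) (h0 / 2).
have hp : 0 < h by rewrite lt_min !divr_gt0.
have hh0 : 0 < h < h0 by rewrite hp gt_min; apply/orP; right; lra.
have hhd : h < d by rewrite gt_min; apply/orP; left; lra.
have := hlt h hh0 p q; rewrite -/C.
have := hd (T - h); rewrite -ball_normE /= opprB addrC subrK gtr0_norm// => /(_ hhd).
have -> : f (T - h) = two_point y C h p q T by rewrite /f opprB addrC subrK.
move=> h1 h2; move: h1; rewrite gtr0_norm; lra.
Qed.

Lemma range_sphere y T p : comes_out_of T0 T1 phi y -> I T ->
  exists Om, [/\ bounded_domain_of Om (range (phi^~ T)),
    range (phi^~ T) = esphere y (enorm (phi p T - y)),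
    forall o, Om o -> enorm (o - y) < enorm (phi p T - y) &
    exists nu lam, [/\ outward_unit_normal A (phi^~ T) Om p nu, G lam
          & derive1 (phi p) T = (F lam)^-1 *: nu] ].
Proof.
move=> hout IT; have [Om hOm /(_ p)[nu [lam [h1 _ h3 h4]]]] := solution_flow sol IT.
have sub : range (phi^~ T) `<=` esphere y (enorm (phi p T - y)).
  by move=> _ [q _ <-]; apply/eqP; rewrite eq_le !equidistant.
have [E inr] := sphere_boundary hOm sub.
by exists Om; split => //; exists nu, lam.
Qed.

(** The derivative of |phi - y|^2 is 2 <phi - y, nu> / F, and it is positive: a small step along -
    [nu] enters the domain, hence the open ball. *)
Lemma radius_increasing y p s t : comes_out_of T0 T1 phi y -> I s -> I t -> s < t ->
  enorm (phi p s - y) < enorm (phi p t - y).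
Proof.
move=> hout Is It st; rewrite lt_enorm.
pose f u := dot (phi p u - y) (phi p u - y).
pose f1 u := 2 * dot (phi p u - y) (derive1 (phi p) u).
have uI u : s <= u <= t -> I u by exact: open_itv_convex.
have hf u : s <= u <= t -> is_derive u (1 : R) f (f1 u).
  move=> /uI Iu; have h1 := is_derive_sub_cst y (solution_is_derive p Iu).
  by apply: (is_derive_eq (is_derive_dot h1 h1)); rewrite /f1 dotC; ring.
have fo u : u \in `]s, t[ -> is_derive u (1 : R) f (f1 u).
  by rewrite in_itv /= => /andP[su ut]; apply: hf; rewrite !ltW.
have fcont : {within `[s, t], continuous f}.
  by apply: derivable_within_continuous => u; rewrite in_itv /= => /hf[].
have [u] := MVT st fo fcont; rewrite in_itv /= => /andP[su ut] E.
rewrite -subr_gt0 [X in 0 < X]E mulr_gt0 ?subr_gt0// mulr_gt0//.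
have Iu : I u by apply: uI; rewrite !ltW.
have [Om [hOm _ inr [nu [lam [[nu1 _ nuO] Glam ->]]]]] := range_sphere p hout Iu.
rewrite dotZr mulr_gt0 ?invr_gt0 ?F_gt0//.
near (0 : R)^'+ => sg.
have sg0 : 0 < sg by [].
have [/inr] : Om (phi p u - sg *: nu) /\ ~ closure Om (phi p u + sg *: nu) by near: sg.
rewrite addrAC lt_enorm; move: (phi p u - y) => P.
rewrite !dotE (dotC nu P) -enorm_sqr -(enorm_sqr nu) nu1 expr1n => h _.
have h2 : sg * sg < 2 * (sg * dot P nu) by move: h; lra.
have : sg * (2 * dot P nu) > 0 by apply: lt_trans (_ : 0 < sg * sg) _; [rewrite mulr_gt0|lra].
by rewrite (pmulr_rgt0 _ sg0); lra.
Unshelve. all: by end_near. Qed.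

End solution.

Theorem theorem1 (R : realType) (n : nat) (hn : (1 <= n)%N)
  (G : set 'rV[R]_n)
  (G_open : open G)
  (G_convex : convex_set (G : set (convex_lmodType 'rV[R]_n)))
  (G_sym : symmetric_set G)
  (G_cone : cone G)
  (G_diag : forall l : R, 0 < l -> G (const_mx l))
  (F : 'rV[R]_n -> R)
  (F_smooth : smooth_on G F)
  (F_sym : symmetric_fun_on G F)
  (F_gt0 : forall x, G x -> 0 < F x)
  (dF_gt0 : forall x, G x -> forall i : 'I_n, 0 < 'D_(delta_mx 0 i) F x)
  (T0 T1 : \bar R)
  (hT : (T0 < T1)%E)
  (M : topologicalType)
  (A : set (chart R n M))
  (hM : closed_connected_manifold A)
  (phi : M -> R -> 'rV[R]_n.+1)
  (phi_sol : smooth_embedded_solution A G F T0 T1 phi)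
  (phi_out : exists y : 'rV[R]_n.+1, comes_out_of T0 T1 phi y) :
  exists (y : 'rV[R]_n.+1) (r : R -> R),
    [/\ forall t, open_itv T0 T1 t -> 0 < r t,
        forall s t, open_itv T0 T1 s -> open_itv T0 T1 t -> s < t -> r s < r t
      & forall t, open_itv T0 T1 t -> range (phi^~ t) = esphere y (r t)].
Proof.
have [y hout] := phi_out.
(* The radius is measured along the trajectory of one point [p], obtained as a preimage of a
   boundary point of the nonempty domain at some time. *)
have [t1 It1 _] := hout 1 ltr01.
have [Om1 hOm1 _] := solution_flow phi_sol It1.
have [_ _ [x1 Omx1] _ _] := hOm1.
have [_ [p _ _] _] := domain_ray y hOm1 Omx1.
exists y, (fun t => enorm (phi p t - y)); split=> [t It|s t Is It st|t It].
- have [Om [[_ _ [w Ow] _ _] _ inr _]] :=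
    range_sphere hM F_gt0 phi_sol G_open G_convex G_sym F_smooth F_sym dF_gt0 p hout It.
  exact: le_lt_trans (enorm_ge0 _) (inr w Ow).
- exact: (radius_increasing hM F_gt0 phi_sol G_open G_convex G_sym F_smooth F_sym dF_gt0).
- by have [Om []] :=
    range_sphere hM F_gt0 phi_sol G_open G_convex G_sym F_smooth F_sym dF_gt0 p hout It.
Qed.
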